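(* Let $\mathbf f=(f_n)_{n\ge 1}$ be a $\boldsymbol{\xi}$-regular infinite iterated function system on $[0,1]$ satisfying the Bounded Distortion Property, let $D\subseteq\mathbb N$ be an infinite subset, and let $m\in\mathbb N$. For any $\overline t=(t_1,\dots,t_m)\in\mathbb R_{>0}^m$, any functions $g_i:\mathbb N\to\mathbb N$, $1\le i\le m$, with $\overline g=(g_1,\dots,g_m)$, and any function $\varphi:\mathbb N\to[M(D),\infty)$ with $\varphi(n)\to\infty$ as $n\to\infty$, where $$M(D):=\max\{\min D,\ (\min D)^{m\max_i t_i}\},$$ the set $$P_m(\mathbf f,D,\varphi,\overline t,\overline g):=\{x\in\mathbb E(\mathbf f,D): a_{g_1(n)}(x)^{t_1}\cdots a_{g_m(n)}(x)^{t_m}\le\varphi(n)\text{ for all }n\in\mathbb N\}$$ satisfies $$\dim_{\mathrm H}P_m(\mathbf f,D,\varphi,\overline t,\overline g)=\dim_{\mathrm H}S(\mathbf f,D,\varphi)=s_0(D;\boldsymbol{\xi}).$$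
   Context: $\mathbb N=\{1,2,\dots\}$ and $\dim_{\mathrm H}$ denotes Hausdorff dimension. An infinite iterated function system (iIFS) is a sequence $\mathbf f=(f_n)_{n\ge1}$ of functions $f_n:[0,1]\to[0,1]$ such that: (i) (Smoothness) $f_n\in C^1([0,1])$ for each $n\ge1$; (ii) (Contraction) there exist an integer $q\geq 1$ and a real number $0<\rho<1$ such that for any $(a_1,\dots,a_q)\in\mathbb N^q$ and $x\in[0,1]$, $0<|(f_{a_1}\circ\cdots\circ f_{a_q})'(x)|\le\rho<1$; (iii) (Open Set Condition) for any $i\ne j$ in $\mathbb N$, $f_i((0,1))\cap f_j((0,1))=\emptyset$. The natural projection is $\Pi_{\mathbf f}:\mathbb N^{\mathbb N}\to[0,1]$, $\Pi_{\mathbf f}((a_n)_{n\ge1})=\lim_{n\to\infty}f_{a_1}\circ\cdots\circ f_{a_n}(1)$, and the attractor is $\Lambda(\mathbf f)=\Pi_{\mathbf f}(\mathbb N^{\mathbb N})$. To all but countably many $x\in\Lambda(\mathbf f)$ there corresponds a unique sequence $(a_n(x))_{n\ge1}\in\mathbb N^{\mathbb N}$ with $x=\lim_{n\to\infty}f_{a_1(x)}\circ\cdots\circ f_{a_n(x)}(1)$, called the sequence of digits of $x$. (For the remaining countably many points, take $(a_n(x))_{n\ge 1}$ to be any fixed choice of such a sequence; a countable set does not affect Hausdorff dimension.) The iIFS is $\boldsymbol{\xi}$-regular, where $\boldsymbol{\xi}=(\xi_n)_{n\ge1}$ is a sequence of positive numbers, if for every $\varepsilon>0$ there are constants $c_1,c_2>0$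 depending on $\varepsilon$ such that $$\frac{c_1}{\xi_n^{1+\varepsilon}}\le|f_n'(x)|\le\frac{c_2}{\xi_n^{1-\varepsilon}}\quad\text{for all }n\in\mathbb N\text{ and all }x\in[0,1].$$ It satisfies the Bounded Distortion Property if there is a constant $\kappa\ge1$ such that for every $n\in\mathbb N$ and $a_1,\dots,a_n\in\mathbb N$, $|(f_{a_1}\circ\cdots\circ f_{a_n})'(x)|\le\kappa|(f_{a_1}\circ\cdots\circ f_{a_n})'(y)|$ for all $x,y\in[0,1]$. For an infinite subset $D\subseteq\mathbb N$ define $$\mathbb E(\mathbf f,D):=\{x\in\Lambda(\mathbf f): a_n(x)\in D\text{ for all }n\in\mathbb N,\ \lim_{n\to\infty}a_n(x)=\infty\},\qquad s_0(D;\boldsymbol{\xi}):=\inf\Big\{s\ge0:\sum_{n\in D}\frac1{\xi_n^s}<\infty\Big\},$$ and, for a function $\varphi:\mathbb N\to[\min D,\infty)$, $$S(\mathbf f,D,\varphi):=\{x\in\mathbb E(\mathbf f,D): a_n(x)\le\varphi(n)\text{ for all }n\in\mathbb N\}.$$ *)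

(* Defs.v *)
From HB Require Import structures.
From mathcomp Require Import all_boot all_order all_algebra.
From mathcomp Require Import all_classical all_reals all_analysis.
Set Implicit Arguments.
Unset Strict Implicit.
Unset Printing Implicit Defensive.
Import Order.TTheory GRing.Theory Num.Theory.
Import numFieldNormedType.Exports.
Local Open Scope classical_set_scope.
Local Open Scope ring_scope.

(* The positive integers are represented by [nat]: every sequence below is
   indexed from 1, its value at index 0 is never used, and the quantifiers over
   indices and digits carry the guard [(0 < n)%N]. *)

Section hausdorff.
Variable R : realType.
Implicit Types (A U : set R) (s delta : R).

Definition diam U : \bar R :=
  ereal_sup [set `|xy.1 - xy.2|%:E | xy in U `*` U].

(* The empty set has weight 0 for every [s], including [s = 0], while a
   one-point set has weight [0 `^ 0 = 1] at [s = 0]. *)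
Definition diam_pow s U : \bar R :=
  if U == set0 then 0%E else (diam U `^ s)%E.

Definition is_delta_cover delta A (U : nat -> set R) : Prop :=
  A `<=` \bigcup_i U i /\ forall i, (diam (U i) <= delta%:E)%E.

Definition hausdorff_premeasure s delta A : \bar R :=
  ereal_inf [set (\sum_(i <oo) diam_pow s (U i))%E
            | U in is_delta_cover delta A].

Definition hausdorff_measure s A : \bar R :=
  ereal_sup [set hausdorff_premeasure s delta A
            | delta in [set delta | 0 < delta]].

Definition hausdorff_dim A : \bar R :=
  ereal_inf [set s%:E | s in [set s | 0 <= s /\ hausdorff_measure s A = 0%E]].

End hausdorff.

Section iifs.
Variable R : realType.
Implicit Types (f : nat -> R -> R) (h : R -> R) (x : R) (a : nat -> nat).

Definition diff_quotient h x (y : R) : R := (h y - h x) / (y - x).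

(* Points near [x] are taken in [0, 1] only, so the derivative is two-sided
   inside the interval and one-sided at 0 and 1, and the values of [h] outside
   [0, 1] play no role. *)
Definition derivable01 h x : Prop :=
  cvg (diff_quotient h x y @[y --> within `[0, 1]%classic x^']).

Definition deriv01 h x : R :=
  lim (diff_quotient h x y @[y --> within `[0, 1]%classic x^']).

Definition C1_01 h : Prop :=
  (forall x, 0 <= x <= 1 -> derivable01 h x) /\
  {within `[0, 1]%classic, continuous (deriv01 h)}.

(* [comp_word f [:: a1; ...; an]] is [f a1 \o ... \o f an]. *)
Definition comp_word f (w : seq nat) : R -> R :=
  foldr (fun k h => f k \o h) id w.

Definition pos_word (w : seq nat) : bool := all (fun k => (0 < k)%N) w.

Record is_iIFS f : Prop := {
  iIFS_maps : forall n, (0 < n)%N ->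
    forall x, 0 <= x <= 1 -> 0 <= f n x <= 1;
  iIFS_smooth : forall n, (0 < n)%N -> C1_01 (f n);
  iIFS_contraction : exists (q : nat) (rho : R),
    [/\ (1 <= q)%N, 0 < rho, rho < 1 &
      forall w : seq nat, size w = q -> pos_word w ->
      forall x, 0 <= x <= 1 ->
        0 < `|deriv01 (comp_word f w) x| /\
        `|deriv01 (comp_word f w) x| <= rho];
  iIFS_open_set : forall i j, (0 < i)%N -> (0 < j)%N -> i <> j ->
    (f i @` `]0, 1[%classic) `&` (f j @` `]0, 1[%classic) = set0
}.

Definition natural_proj f a : R :=
  lim (comp_word f [seq a i | i <- iota 1 n] 1 @[n --> \oo]).

Definition attractor f : set R :=
  [set natural_proj f a | a in [set a | forall n, (0 < n)%N -> (0 < a n)%N]].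

(* [dig x n] is the [n]-th digit of [x]; where [x] has several expansions,
   [dig x] is an arbitrary one of them. *)
Definition is_digits f (dig : R -> nat -> nat) : Prop :=
  forall x, attractor f x ->
    (forall n, (0 < n)%N -> (0 < dig x n)%N) /\ natural_proj f (dig x) = x.

Definition is_regular f (xi : nat -> R) : Prop :=
  forall eps : R, 0 < eps -> exists c1 c2 : R,
    [/\ 0 < c1, 0 < c2 &
      forall n, (0 < n)%N -> forall x, 0 <= x <= 1 ->
        c1 / xi n `^ (1 + eps) <= `|deriv01 (f n) x| /\
        `|deriv01 (f n) x| <= c2 / xi n `^ (1 - eps)].

Definition bounded_distortion f : Prop :=
  exists kappa : R, 1 <= kappa /\
    forall w : seq nat, (0 < size w)%N -> pos_word w ->
    forall x y : R, 0 <= x <= 1 -> 0 <= y <= 1 ->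
      `|deriv01 (comp_word f w) x| <= kappa * `|deriv01 (comp_word f w) y|.

Definition digits_to_infty f (dig : R -> nat -> nat) (D : set nat) : set R :=
  [set x | [/\ attractor f x,
               forall n, (0 < n)%N -> D (dig x n) &
               dig x @ \oo --> \oo]].

Definition s0 (D : set nat) (xi : nat -> R) : \bar R :=
  ereal_inf [set s%:E | s in
    [set s : R | 0 <= s /\ (\esum_(n in D) (1 / xi n `^ s)%:E < +oo)%E]].

Definition digits_bounded f (dig : R -> nat -> nat) (D : set nat)
    (phi : nat -> R) : set R :=
  [set x | digits_to_infty f dig D x /\
           forall n, (0 < n)%N -> (dig x n)%:R <= phi n].

Definition digit_products_bounded f (dig : R -> nat -> nat) (D : set nat)
    (phi : nat -> R) (m : nat) (t : 'I_m -> R) (g : 'I_m -> nat -> nat) :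
    set R :=
  [set x | digits_to_infty f dig D x /\
           forall n, (0 < n)%N ->
             \prod_(i < m) (dig x (g i n))%:R `^ t i <= phi n].

(* The least element of a nonempty [D]; 0 if [D] is empty. *)
Definition min_nat (D : set nat) : nat :=
  xget 0%N [set d | D d /\ forall k, D k -> (d <= k)%N].

(* Starting the maximum at 0 is harmless: it is used with [0 < m], [0 < t i]. *)
Definition threshold (D : set nat) (m : nat) (t : 'I_m -> R) : R :=
  Num.max (min_nat D)%:R
    ((min_nat D)%:R `^ (m%:R * \big[Num.max/0]_(i < m) t i)).

End iifs.

(* Main.v *)
Require Import Defs.
From HB Require Import structures.
From mathcomp Require Import all_boot all_order all_algebra.
From mathcomp Require Import all_classical all_reals all_analysis.
From mathcomp Require Import ring lra.
Set Implicit Arguments.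
Unset Strict Implicit.
Unset Printing Implicit Defensive.
Import Order.TTheory GRing.Theory Num.Theory.
Import numFieldNormedType.Exports.
Local Open Scope classical_set_scope.
Local Open Scope ring_scope.

(* The upper bound: for s > s0, every x in E(f, D) has a tail in the set F of
   points all of whose digits lie in D and exceed M. F is covered by its images
   f_n(F) for n in D, n >= M, and for M large the s-th powers of the Lipschitz
   constants of these f_n sum to less than 1/2. So the s-dimensional Hausdorff
   content of F is at most half of itself, hence 0, and countably many
   bilipschitz copies of F cover E(f, D).

   The lower bound: let s < s0 and b_v := c1 / xi_v^(1+eps) <= |f_v'|, with
   (1+eps)s < s0. Choose finite blocks l_j of digits of D, going to infinity,
   with sum of b_v^s over l_j at least 4 and f_v([0,1]) inside (0,1), and draw
   the n-th digit from l_(k n), where k grows so slowly that the digit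
   constraints hold and that the smallest b_v and the distance of f_v([0,1]) to
   {0,1} for v in l_(k n) are bounded below in terms of 2^(-n). A point whose
   digits go to infinity has only one expansion. Give the cylinder of
   v_1, ..., v_n the mass prod_i b_(v_i)^s / 4: the factor 4^(-n) absorbs the
   distortion of the n-th step, and two points whose digits first differ after n
   places are at distance at least (const * mass of their common cylinder)^(1/s).
   Hence a set U meeting the construction lies in one cylinder of mass at most
   C diam(U)^s, and cylinders of total mass less than 1 cannot cover all paths. *)

(** * Derivatives relative to [0,1]: mean value theorem and chain rule *)

Section derivative_on_the_unit_interval.
Variable R : realType.
Implicit Types (h g : R -> R) (x y l e : R).

Lemma derivable01_near h x e : derivable01 h x -> 0 < e ->
  \forall y \near x, y != x -> 0 <= y <= 1 ->
    `|deriv01 h x - diff_quotient h x y| < e.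
Proof.
move=> /cvgrPdist_lt /[apply]; rewrite !near_withinE => hd.
near=> y => yx y01; suff : y != x -> y \in `[0, 1] ->
  `|deriv01 h x - diff_quotient h x y| < e by apply; rewrite // in_itv.
by near: y.
Unshelve. all: by end_near. Qed.

Lemma derivable01_near_dist h x e : derivable01 h x -> 0 < e ->
  \forall y \near x, 0 <= y <= 1 -> `|h x - h y| < e.
Proof.
move=> hd e0.
(* Near [x] the quotient is within 1 of the derivative, so [|deriv01 h x| + 1] bounds the growth of
   [h] away from [x]. *)
have d0 : 0 < e / (`|deriv01 h x| + 1) by rewrite divr_gt0// ltr_wpDl.
have H1 := derivable01_near hd ltr01.
have nx : \forall y \near x, `|x - y| < e / (`|deriv01 h x| + 1).
  by exists (e / (`|deriv01 h x| + 1)).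
near=> y => y01.
have [->|yx] := eqVneq y x; first by rewrite subrr normr0.
have yx0 : y - x != 0 by rewrite subr_eq0.
have h1 : `|deriv01 h x - diff_quotient h x y| < 1.
  by move: yx y01; near: y.
have h2 : `|x - y| < e / (`|deriv01 h x| + 1) by near: y.
have h3 : `|diff_quotient h x y| < `|deriv01 h x| + 1.
  have := ler_distD (deriv01 h x) (diff_quotient h x y) 0.
  rewrite !subr0 => /le_lt_trans; apply.
  by rewrite addrC ltrD2l distrC.
have -> : h x - h y = diff_quotient h x y * (x - y).
  rewrite -[x - y]opprB -[h x - h y]opprB mulrN /diff_quotient; congr (- _).
  by rewrite divfK.
rewrite normrM; move: h2; rewrite ltr_pdivlMr; last by rewrite ltr_wpDl.
apply: le_lt_trans.
by rewrite mulrC ler_wpM2l// ltW.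
Unshelve. all: by end_near. Qed.

Lemma derivable01_within_continuous h :
  (forall x, 0 <= x <= 1 -> derivable01 h x) ->
  {within `[0, 1]%classic, continuous h}.
Proof.
move=> hd; apply/subspace_continuousP => x x01; apply/cvgrPdist_lt => e e0.
rewrite near_withinE; near=> y => y01.
move: y01; rewrite /= in_itv /=; near: y.
by apply: derivable01_near_dist => //; apply: hd; move: x01; rewrite /= in_itv.
Unshelve. all: by end_near. Qed.

Lemma is_derive_deriv01 h x : 0 < x < 1 -> derivable01 h x ->
  is_derive x 1 h (deriv01 h x).
Proof.
move=> /andP[x0 x1] hd.
have hlim : (fun k => k^-1 *: ((h \o shift x) (k *: 1) - h x)) @ 0^' -->
    deriv01 h x.
  apply/cvgrPdist_lt => e e0.
  have nx : \forall y \near x, y != x -> `|deriv01 h x - diff_quotient h x y| < e.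
    near=> y => yx.
    have : 0 <= y <= 1.
      apply/andP; split; apply: ltW; near: y.
        exact: lt_nbhsr.
      exact: lt_nbhsl.
    by move: yx; near: y; exact: derivable01_near.
  move/nbhs0P : nx => nx; rewrite near_withinE; near=> k => k0.
  have : `|deriv01 h x - diff_quotient h x (x + k)| < e.
    have : x + k != x by rewrite -subr_eq0 addrAC subrr add0r.
    by near: k; exact: nx.
  rewrite /diff_quotient /= (addrAC x k) subrr add0r => He.
  by rewrite /GRing.scale/= mulr1 (addrC k x) mulrC.
split.
  by apply/cvg_ex; eexists; exact: hlim.
by rewrite /derive; exact: (cvg_lim (@norm_hausdorff _ _) hlim).
Unshelve. all: by end_near. Qed.

Lemma derivable01_MVT h x y : (forall x, 0 <= x <= 1 -> derivable01 h x) ->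
  0 <= x <= 1 -> 0 <= y <= 1 ->
  exists2 c : R, 0 <= c <= 1 & `|h x - h y| = `|deriv01 h c| * `|x - y|.
Proof.
move=> hd; wlog xy : x y / x < y => [wl|] x01 y01.
  have [xy|yx|->] := ltgtP x y; first exact: wl.
    by have [c c01 e] := wl _ _ yx y01 x01; exists c => //; rewrite distrC e distrC.
  by exists y => //; rewrite !subrr !normr0 mulr0.
have xy01 z : x <= z <= y -> 0 <= z <= 1 by move: x01 y01; lra.
have [|z zxy|c cxy e] := MVT (f := h) (df := deriv01 h) xy.
- move=> z; rewrite in_itv /= => zxy; apply: is_derive_deriv01.
    by move: x01 y01 zxy; lra.
  by apply: hd; move: x01 y01 zxy; lra.
- apply: (continuous_subspaceW _ (derivable01_within_continuous hd)).
  by move=> t; rewrite /= !in_itv /=; exact: xy01.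
exists c; first by apply: xy01; move: cxy; rewrite in_itv /= => /andP[/ltW-> /ltW->].
by rewrite distrC e normrM (distrC y).
Qed.

(** The quotient of [h \o g] factors through [g y - g x]. The last hypothesis keeps this difference
    nonzero, so [g y] tends to [g x] within the punctured neighbourhood on which the quotient of [h]
    converges. *)
Lemma derivable01_comp h g x : derivable01 g x -> derivable01 h (g x) ->
  (forall y, 0 <= y <= 1 -> 0 <= g y <= 1) ->
  (forall y, 0 <= y <= 1 -> g y = g x -> y = x) ->
  derivable01 (h \o g) x.
Proof.
move=> gd hd g01 gI.
suff : diff_quotient (h \o g) x y @[y --> within `[0, 1]%classic x^'] -->
   deriv01 h (g x) * deriv01 g x by move=> l; apply/cvg_ex; eexists; exact: l.
have gxy : g y @[y --> within `[0, 1]%classic x^'] -->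
    within `[0, 1]%classic (g x)^'.
  move=> A; rewrite /= /within /= nbhs_filterE => -[e /= e0 eA].
  have := derivable01_near_dist gd e0.
  move=> [d /= d0 dA].
  exists d => //= y xy yx y01.
  apply: eA => /=.
  - by apply: dA => //; move: y01; rewrite in_itv.
  - by apply: contra_neq yx; apply: gI; move: y01; rewrite in_itv.
  - by move: y01; rewrite !in_itv; exact: g01.
apply: (cvg_trans _ (cvgM (cvg_comp _ _ gxy hd) gd)).
apply: near_eq_cvg; rewrite near_withinE.
near=> y => y01; have yx : y != x.
  by near: y; exact: nbhs_dnbhs_neq.
rewrite /diff_quotient /= mulrA divfK// subr_eq0.
by apply: contra_neq yx; apply: gI; move: y01; rewrite /= in_itv.
Unshelve. all: by end_near. Qed.

End derivative_on_the_unit_interval.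

(** * Bilipschitz maps of the unit interval and the position of their images *)

Section bilipschitz_maps.
Variable R : realType.
Implicit Types (h : R -> R) (b L x y e : R).

Definition bilip01 b L h := forall x y, 0 <= x <= 1 -> 0 <= y <= 1 ->
  b * `|x - y| <= `|h x - h y| <= L * `|x - y|.

Lemma bilip01_upper_gt0 b L h : 0 < b -> bilip01 b L h -> 0 < L.
Proof.
move=> b0 /(_ 0 1); rewrite !lexx !ler01 sub0r normrN normr1 !mulr1.
by move=> /(_ isT isT) /andP[/(lt_le_trans b0) /lt_le_trans]; apply.
Qed.

Lemma bilip01N b L h : bilip01 b L h -> bilip01 b L (fun x => - h x).
Proof. by move=> H x y x01 y01; rewrite -opprD normrN; exact: H. Qed.

Lemma bilip01_inj b L h : 0 < b -> bilip01 b L h ->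
  {in `[0, 1] &, injective h}.
Proof.
move=> b0 H x y; rewrite !in_itv /= => x01 y01 hxy.
have /andP[+ _] := H x y x01 y01.
rewrite hxy subrr normr0 pmulr_rle0// normr_le0 subr_eq0.
by move/eqP.
Qed.

Lemma bilip01_continuous b L h : 0 < b -> bilip01 b L h ->
  {within `[0, 1], continuous h}.
Proof.
move=> b0 H; have L0 := bilip01_upper_gt0 b0 H.
apply/subspace_continuousP => x; rewrite /= in_itv /= => x01.
apply/cvgrPdist_lt => e e0; rewrite near_withinE; near=> y.
rewrite /= in_itv /= => y01.
have /andP[_ /le_lt_trans] := H x y x01 y01; apply.
rewrite mulrC -ltr_pdivlMr//; near: y.
by exists (e / L) => //=; rewrite divr_gt0.
Unshelve. all: by end_near. Qed.

(** A continuous injective map on an interval is strictly monotone; the two cases are the two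
    orientations. *)
Lemma bilip01_mono b L h x : 0 < b -> bilip01 b L h -> 0 < x < 1 ->
  (h 0 < h x /\ h x < h 1) \/ (h 1 < h x /\ h x < h 0).
Proof.
move=> b0 H /andP[x0 x1].
have i0 : (0 : R) \in `[0, 1] by rewrite in_itv /= lexx ler01.
have i1 : (1 : R) \in `[0, 1] by rewrite in_itv /= lexx ler01.
have ix : x \in `[0, 1] by rewrite in_itv /= !ltW.
have [m|m] := itv_continuous_inj_mono (bilip01_continuous b0 H)
  (bilip01_inj b0 H); [left|right]; split; exact: m.
Qed.

Lemma bilip01_open_image b L h v : 0 < b -> bilip01 b L h ->
  (h 0 < v /\ v < h 1) \/ (h 1 < v /\ v < h 0) ->
  exists2 t : R, 0 < t < 1 & h t = v.
Proof.
move=> b0 H hv.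
have [|t] := IVT (v := v) ler01 (bilip01_continuous b0 H).
  rewrite ge_min le_max; case: hv => -[/ltW-> /ltW->]; rewrite ?orbT //.
rewrite in_itv /= => /andP[t0 t1] htv; exists t => //.
have tn0 : t != 0 by apply: contraPneq hv => t0'; rewrite -htv t0' !ltxx; lra.
have tn1 : t != 1 by apply: contraPneq hv => t1'; rewrite -htv t1' !ltxx; lra.
by rewrite lt_neqAle eq_sym tn0 t0 lt_neqAle tn1.
Qed.

(** By monotonicity and the lower constant, the image of (0,1) under [h] contains the ball about
    [h x] whose radius is the claimed bound. If [h' y] lay in this ball, so would [h' y'] for an
    interior [y'] close to [y], and the two open images would meet. *)
Lemma bilip01_separated b L h b' L' h' x y : 0 < b -> bilip01 b L h ->
  0 < b' -> bilip01 b' L' h' ->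
  (forall s t, 0 < s < 1 -> 0 < t < 1 -> h s <> h' t) ->
  0 < x < 1 -> 0 <= y <= 1 -> b * Num.min x (1 - x) <= `|h x - h' y|.
Proof.
move=> b0 H b'0 H' dis x01 y01; rewrite leNgt; apply/negP => lt.
have L'0 := bilip01_upper_gt0 b'0 H'.
pose gap := b * Num.min x (1 - x) - `|h x - h' y|.
have gap0 : 0 < gap by rewrite subr_gt0.
(* This value gives [eta < 1] and [L' * eta < gap]: pulling [y] towards the midpoint by the fraction
   [eta] makes it interior and keeps the distance below the bound. *)
pose eta := gap / (gap + L').
have gL : 0 < gap + L' by rewrite addr_gt0.
have eta0 : 0 < eta by rewrite divr_gt0.
have eta1 : eta < 1 by rewrite ltr_pdivrMr// mul1r ltrDl.
have etaL : L' * eta < gap.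
  by rewrite /eta mulrA ltr_pdivrMr// mulrC ltr_pM2l// ltrDr.
pose y' := y + eta * (2^-1 - y).
have y'01 : 0 < y' < 1 by rewrite /y'; move: y01; nra.
have y'01W : 0 <= y' <= 1 by case/andP: y'01 => /ltW-> /ltW->.
have near' : `|h x - h' y'| < b * Num.min x (1 - x).
  have /andP[_ d] := H' y y' y01 y'01W.
  have d' : `|y - y'| <= eta.
    rewrite /y' opprD addNKr normrN normrM gtr0_norm//.
    have h1 : `|2^-1 - y| <= 1 by rewrite ler_norml; move: y01; lra.
    by rewrite ler_piMr// ltW.
  have := ler_distD (h' y) (h x) (h' y').
  have : L' * `|y - y'| < gap.
    by apply: le_lt_trans etaL; rewrite ler_wpM2l// ltW.
  rewrite /gap; lra.
have x01W : 0 <= x <= 1 by case/andP: x01 => /ltW-> /ltW->.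
have /andP[d0 _] := H x 0 x01W (introT andP (conj (lexx 0) ler01)).
have /andP[d1 _] := H x 1 x01W (introT andP (conj ler01 (lexx 1))).
have m0 : Num.min x (1 - x) <= x by rewrite ge_min lexx.
have m1 : Num.min x (1 - x) <= 1 - x by rewrite ge_min lexx orbT.
have [x0 x1] := andP x01.
have b0m : b * Num.min x (1 - x) <= b * `|x - 0|.
  by rewrite ler_pM2l// subr0 gtr0_norm.
have b1m : b * Num.min x (1 - x) <= b * `|x - 1|.
  by rewrite ler_pM2l// distrC gtr0_norm// subr_gt0.
move: near'; rewrite ltr_norml => /andP[n1 n2].
have [|t t01 ht] := bilip01_open_image (v := h' y') b0 H; last exact: (dis t y').
have [[q1 q2]|[q1 q2]] := bilip01_mono b0 H x01; [left|right].
- move: d0 d1; rewrite [`|h x - h 0|]gtr0_norm ?subr_gt0//.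
  rewrite [`|h x - h 1|]ltr0_norm ?subr_lt0//; lra.
- move: d0 d1; rewrite [`|h x - h 0|]ltr0_norm ?subr_lt0//.
  rewrite [`|h x - h 1|]gtr0_norm ?subr_gt0//; lra.
Qed.

(** Both maps start at the common minimum [e] and rise continuously above it. The smaller of the two
    values at the midpoint is therefore attained by the other map as well, strictly away from the
    point where that map equals [e]. *)
Lemma bilip01_common_min b L h b' L' h' e x y : 0 < b -> bilip01 b L h ->
  0 < b' -> bilip01 b' L' h' ->
  (forall s, 0 <= s <= 1 -> e <= h s /\ e <= h' s) ->
  0 <= x <= 1 -> 0 <= y <= 1 -> h x = e -> h' y = e ->
  exists s t : R, [/\ 0 < s < 1, 0 < t < 1 & h s = h' t].
Proof.
move=> + + + + eh.
have half01 : 0 < (2^-1 : R) < 1 by lra.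
have gt_half b1 L1 h1 : 0 < b1 -> bilip01 b1 L1 h1 ->
    (forall s, 0 <= s <= 1 -> e <= h1 s) -> e < h1 2^-1.
  move=> b10 H1 e1; have e0 := e1 0 (introT andP (conj (lexx 0) ler01)).
  have e1' := e1 1 (introT andP (conj ler01 (lexx 1))).
  have [[]|[]] := bilip01_mono b10 H1 half01; lra.
wlog le12 : b b' L L' h h' x y eh / h 2^-1 <= h' 2^-1.
  move=> wl b0 H b'0 H' x01 y01 hx hy.
  have [le12|/ltW le21] := leP (h 2^-1) (h' 2^-1).
    exact: (wl b b' L L' h h' x y).
  have [|t [s [t01 s01 ts]]] := wl b' b L' L h' h y x _ le21 b'0 H' b0 H y01 x01 hy hx.
    by move=> s /eh [].
  by exists s, t.
move=> b0 H b'0 H' x01 y01 hx hy.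
have e1 : e < h 2^-1 by apply: gt_half b0 H _ => s /eh[].
have cont := bilip01_continuous b'0 H'.
have hv : Num.min (h' y) (h' 2^-1) <= h 2^-1 <= Num.max (h' y) (h' 2^-1).
  by rewrite ge_min le_max hy (ltW e1) le12 orbT.
have [y2|y2] := leP y 2^-1.
- have sub : `[y, 2^-1] `<=` `[0, 1].
    by move=> z; rewrite /= !in_itv /=; move: y01; lra.
  have [t] := IVT y2 (continuous_subspaceW sub cont) hv.
  rewrite in_itv /= => /andP[ty t2] ht.
  exists 2^-1, t; split => //.
  have : t != y by apply: contraTneq e1 => ty'; rewrite -ht ty' hy ltxx.
  by rewrite neq_lt; move: y01; lra.
- have sub : `[2^-1, y] `<=` `[0, 1].
    by move=> z; rewrite /= !in_itv /=; move: y01; lra.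
  rewrite minC maxC in hv.
  have [t] := IVT (ltW y2) (continuous_subspaceW sub cont) hv.
  rewrite in_itv /= => /andP[t2 ty] ht.
  exists 2^-1, t; split => //.
  have : t != y by apply: contraTneq e1 => ty'; rewrite -ht ty' hy ltxx.
  by rewrite neq_lt; move: y01; lra.
Qed.

End bilipschitz_maps.

Lemma expr_small (R : realType) (r e : R) : 0 < r -> r < 1 -> 0 < e ->
  exists N, r ^+ N < e.
Proof.
move=> r0 r1 e0; have rn : `|r| < 1 by rewrite gtr0_norm.
have /cvgrPdist_lt/(_ e e0)[N _ HN] := cvg_expr rn.
exists N; have := HN N (leqnn N).
by rewrite /= sub0r normrN gtr0_norm// exprn_gt0.
Qed.

(** * Contraction of cylinders and convergence of the natural projection *)

Section natural_projection.
Variable R : realType.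
Implicit Types (f : nat -> R -> R) (a b : nat -> nat) (w : seq nat) (x y : R).

Definition digit_prefix a n := [seq a i | i <- iota 1 n].
Definition digit_shift n a : nat -> nat := fun i => a (i + n)%N.
Definition pos_digits a := forall n, (0 < n)%N -> (0 < a n)%N.

Lemma digit_prefixS a n :
  digit_prefix a n.+1 = a 1%N :: digit_prefix (digit_shift 1 a) n.
Proof.
rewrite /digit_prefix /=; congr cons.
rewrite (iotaDl 1 1) -map_comp; apply: eq_map => i /=.
by rewrite /digit_shift addnC.
Qed.

Lemma digit_prefix_cat a m n : digit_prefix a (m + n) =
  digit_prefix a m ++ digit_prefix (digit_shift m a) n.
Proof.
elim: m a => [|m IH] a.
  rewrite add0n; apply: eq_map => i /=; by rewrite /digit_shift addn0.
rewrite addSn !digit_prefixS IH cat_cons; congr (_ :: _ ++ _).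
by apply: eq_map => i; rewrite /digit_shift -addnA addn1.
Qed.

Lemma pos_digits_shift n a : pos_digits a -> pos_digits (digit_shift n a).
Proof. by move=> pa i i0; apply: pa; rewrite addn_gt0 i0. Qed.

Lemma pos_digits_prefix n a : pos_digits a -> pos_word (digit_prefix a n).
Proof.
move=> pa; apply/allP => k /mapP[i]; rewrite mem_iota => /andP[i0 _] ->.
exact: pa.
Qed.

Lemma size_digit_prefix a n : size (digit_prefix a n) = n.
Proof. by rewrite size_map size_iota. Qed.

Lemma comp_word_cat f w1 w2 x :
  comp_word f (w1 ++ w2) x = comp_word f w1 (comp_word f w2 x).
Proof. by elim: w1 => //= k w ->. Qed.

Variables (f : nat -> R -> R) (xi : nat -> R).
Hypothesis f_iIFS : is_iIFS f.
Hypothesis xi_gt0 : forall n, (0 < n)%N -> 0 < xi n.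
Hypothesis f_regular : is_regular f xi.

(** The mean value theorem turns the bounds on the derivative into bounds on distances. *)
Lemma regular_bilip (eps : R) : 0 < eps -> exists c1 c2 : R,
  [/\ 0 < c1, 0 < c2 & forall n, (0 < n)%N ->
    bilip01 (c1 / xi n `^ (1 + eps)) (c2 / xi n `^ (1 - eps)) (f n)].
Proof.
move=> /f_regular[c1 [c2 [c10 c20 H]]]; exists c1, c2; split => // n n0 x y x01 y01.
have [c c01 ->] := derivable01_MVT (iIFS_smooth f_iIFS n0).1 x01 y01.
by have [H1 H2] := H n n0 c c01; rewrite !ler_wpM2r.
Qed.

Lemma iIFS_bilip n : (0 < n)%N ->
  exists b L : R, [/\ 0 < b, 0 < L & bilip01 b L (f n)].
Proof.
move=> n0; have [c1 [c2 [c10 c20 H]]] := regular_bilip ltr01.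
by do 2 eexists; split; last exact: (H n n0); rewrite divr_gt0// powR_gt0// xi_gt0.
Qed.

Lemma comp_word_maps w x : pos_word w -> 0 <= x <= 1 ->
  0 <= comp_word f w x <= 1.
Proof.
by elim: w => //= k w IH /andP[k0 w0] x01; apply: (iIFS_maps f_iIFS k0); exact: IH.
Qed.

Lemma comp_word_inj w x y : pos_word w -> 0 <= x <= 1 -> 0 <= y <= 1 ->
  comp_word f w x = comp_word f w y -> x = y.
Proof.
elim: w => //= k w IH /andP[k0 w0] x01 y01 e; apply: IH => //.
have [b [L [b0 _ H]]] := iIFS_bilip k0.
by apply: (bilip01_inj b0 H) => //; rewrite in_itv /=; exact: comp_word_maps.
Qed.

Lemma derivable01_id x : derivable01 (@id R) x.
Proof.
apply/cvg_ex; exists 1; apply/cvgrPdist_lt => e e0; rewrite !near_withinE.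
near=> y => yx _; rewrite /diff_quotient divff ?subr_eq0//.
by rewrite subrr normr0.
Unshelve. all: by end_near. Qed.

Lemma comp_word_derivable w x : pos_word w -> 0 <= x <= 1 ->
  derivable01 (comp_word f w) x.
Proof.
elim: w x => [|k w IH] x /=; first by move=> _ _; exact: derivable01_id.
move=> /andP[k0 w0] x01; apply: derivable01_comp.
- exact: IH.
- by apply: (iIFS_smooth f_iIFS k0).1; exact: comp_word_maps.
- by move=> y y01; exact: comp_word_maps.
- by move=> y y01; exact: comp_word_inj.
Qed.

(** The contraction condition speaks of words of length [q] only. Cutting [w] into such blocks gives
    one factor [rho] for each; an incomplete last block still maps [0,1] into itself and gives the
    factor 1. *)
Lemma comp_word_contraction : exists (q : nat) (rho : R),
  [/\ (0 < q)%N, 0 < rho, rho < 1 & forall w x y, pos_word w ->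
    0 <= x <= 1 -> 0 <= y <= 1 ->
    `|comp_word f w x - comp_word f w y| <= rho ^+ (size w %/ q)].
Proof.
have [q [rho [q0 rho0 rho1 H]]] := iIFS_contraction f_iIFS.
exists q, rho; split => //.
move=> w; have [k] := ubnP (size w); elim: k w => // k IH w.
rewrite ltnS => wk x y w0 x01 y01.
have w01 z : 0 <= z <= 1 -> 0 <= comp_word f w z <= 1 by exact: comp_word_maps.
have [wq|qw] := ltnP (size w) q.
  rewrite divn_small// expr0 ler_norml.
  by move: (w01 x x01) (w01 y y01); lra.
have stq : size (take q w) = q by rewrite size_takel.
move: w0; rewrite -(cat_take_drop q w) /pos_word all_cat => /andP[t0 d0].
rewrite !comp_word_cat size_cat stq divnDl// divnn q0 exprD expr1.
have dx := comp_word_maps d0 x01; have dy := comp_word_maps d0 y01.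
have [c c01 ->] := derivable01_MVT (fun z => comp_word_derivable t0) dx dy.
have [_ Hc] := H _ stq t0 c c01.
apply: ler_pM => //; apply: IH => //.
rewrite size_drop; apply: leq_trans wk.
by rewrite ltn_subrL q0 (leq_trans q0).
Qed.

(** The starting point may be any [x] in place of 1, because the diameters of the nested cylinders
    tend to 0. *)
Lemma natural_proj_cvg a x : pos_digits a -> 0 <= x <= 1 ->
  comp_word f (digit_prefix a n) x @[n --> \oo] --> natural_proj f a.
Proof.
move=> pa x01.
have [q [rho [q0 rho0 rho1 H]]] := comp_word_contraction.
have close e : 0 < e -> exists N, forall n y z, (N <= n)%N ->
    0 <= y <= 1 -> 0 <= z <= 1 ->
    `|comp_word f (digit_prefix a N) y - comp_word f (digit_prefix a n) z| < e.
  (* The first [N * q] letters form [N] contracting blocks; whatever follows them stays in [0,1]. *)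
  move=> /(expr_small rho0 rho1)[N eN]; exists (N * q)%N => n y z Nn y01 z01.
  rewrite -(subnKC Nn) digit_prefix_cat comp_word_cat.
  apply: le_lt_trans eN.
  rewrite -[X in rho ^+ X](mulnK _ q0) -[X in (X %/ q)%N](size_digit_prefix a).
  apply: H => //; first exact: pos_digits_prefix.
  by apply: comp_word_maps => //; exact/pos_digits_prefix/pos_digits_shift.
have one01 : 0 <= (1 : R) <= 1 by rewrite ler01 lexx.
have c1 : comp_word f (digit_prefix a n) 1 @[n --> \oo] --> natural_proj f a.
  apply/cauchy_cvgP/cauchy_exP => e e0.
  have [N HN] := close e e0.
  by exists (comp_word f (digit_prefix a N) 1), N => // n /= Nn; exact: HN.
apply/cvgrPdist_lt => e e0.
have e2 : 0 < e / 2 by rewrite divr_gt0.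
have e4 : 0 < e / 2 / 2 by rewrite divr_gt0.
have [N HN] := close _ e4.
have /cvgrPdist_lt/(_ _ e2) c1e := c1.
near=> n.
have Nn : (N <= n)%N by near: n; exists N.
have h1 := HN n 1 1 Nn one01 one01.
have h2 := HN n 1 x Nn one01 x01.
have h3 : `|natural_proj f a - comp_word f (digit_prefix a n) 1| < e / 2 by near: n.
move: h1 h2 h3; rewrite !ltr_norml; lra.
Unshelve. all: by end_near. Qed.

Lemma natural_proj01 a : pos_digits a -> 0 <= natural_proj f a <= 1.
Proof.
move=> pa; have one01 : 0 <= (1 : R) <= 1 by rewrite ler01 lexx.
have c := natural_proj_cvg pa one01.
have cm n := comp_word_maps (pos_digits_prefix n pa) one01.
apply/andP; split.
  by apply: (limr_ge _ _); [apply/cvg_ex; eexists; exact: c|apply: nearW => n; case/andP: (cm n)].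
by apply: (limr_le _ _); [apply/cvg_ex; eexists; exact: c|apply: nearW => n; case/andP: (cm n)].
Qed.

Lemma natural_projS a : pos_digits a ->
  natural_proj f a = f (a 1%N) (natural_proj f (digit_shift 1 a)).
Proof.
move=> pa; have one01 : 0 <= (1 : R) <= 1 by rewrite ler01 lexx.
have [b [L [b0 L0 H]]] := iIFS_bilip (pa 1%N isT).
have ps := pos_digits_shift 1 pa.
have := natural_proj_cvg pa one01; rewrite -cvg_shiftS => c1.
apply: (cvg_unique (@norm_hausdorff _ _) c1).
apply/cvgrPdist_lt => e e0.
have eL : 0 < e / L by rewrite divr_gt0.
have /cvgrPdist_lt/(_ _ eL) ce := natural_proj_cvg ps one01.
near=> n; rewrite [X in `|_ - X|](_ : _ = comp_word f (digit_prefix a n.+1) 1)//.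
rewrite digit_prefixS /=.
have /andP[_ /le_lt_trans] := H _ _ (natural_proj01 ps)
  (comp_word_maps (pos_digits_prefix n ps) one01); apply.
by rewrite mulrC -ltr_pdivlMr//; near: n.
Unshelve. all: by end_near. Qed.

Lemma natural_proj_prefix a n : pos_digits a -> natural_proj f a =
  comp_word f (digit_prefix a n) (natural_proj f (digit_shift n a)).
Proof.
elim: n a => [|n IH] a pa.
  rewrite /=; congr natural_proj; apply/funext => i; by rewrite /digit_shift addn0.
rewrite natural_projS// digit_prefixS /=; congr f.
rewrite IH; last exact: pos_digits_shift.
congr (comp_word _ _ (natural_proj _ _)); apply/funext => i.
by rewrite /digit_shift -addnA addn1.
Qed.

End natural_projection.

(** * Uniqueness of expansions, and the distance between points with different digits *)

Section uniqueness_of_digits.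
Variables (R : realType) (f : nat -> R -> R) (xi : nat -> R).
Hypothesis f_iIFS : is_iIFS f.
Hypothesis xi_gt0 : forall n, (0 < n)%N -> 0 < xi n.
Hypothesis f_regular : is_regular f xi.
Implicit Types (a b : nat -> nat) (x y : R).

Lemma iIFS_disjoint i j x y : (0 < i)%N -> (0 < j)%N -> i <> j ->
  0 < x < 1 -> 0 < y < 1 -> f i x <> f j y.
Proof.
move=> i0 j0 ij x01 y01 e.
have : ((f i @` `]0, 1[%classic) `&` (f j @` `]0, 1[%classic)) (f i x).
  by split; [exists x|exists y => //]; rewrite //= in_itv.
by rewrite (iIFS_open_set f_iIFS i0 j0 ij).
Qed.

(** Two maps that reach the same endpoint of [0,1] both cover a one-sided neighbourhood of it, which
    the open set condition forbids for distinct indices. *)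
Lemma iIFS_endpoint_unique (c : R) (i j : nat) x y : (c = 0) \/ (c = 1) ->
  (0 < i)%N -> (0 < j)%N -> 0 <= x <= 1 -> 0 <= y <= 1 ->
  f i x = c -> f j y = c -> i = j.
Proof.
move=> c01 i0 j0 x01 y01 fx fy; apply: contrapT => ij.
have [b [L [b0 _ H]]] := iIFS_bilip f_iIFS xi_gt0 f_regular i0.
have [b' [L' [b'0 _ H']]] := iIFS_bilip f_iIFS xi_gt0 f_regular j0.
have maps s : 0 <= s <= 1 -> 0 <= f i s <= 1 /\ 0 <= f j s <= 1.
  by move=> s01; split; exact: (iIFS_maps f_iIFS).
case: c01 => cE.
  have [|||s [t [s01 t01]]] := bilip01_common_min (e := 0) b0 H b'0 H' _ x01 y01.
  - by move=> s /maps[/andP[-> _] /andP[-> _]].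
  - by rewrite fx.
  - by rewrite fy.
  exact: iIFS_disjoint.
(* Negating both maps turns the common maximum 1 into the common minimum -1. *)
have [|||s [t [s01 t01]]] := bilip01_common_min (e := -1) b0 (bilip01N H)
  b'0 (bilip01N H') _ x01 y01.
- by move=> s /maps[/andP[_ ?] /andP[_ ?]]; rewrite !lerN2.
- by rewrite fx cE.
- by rewrite fy cE.
by move/oppr_inj; exact: iIFS_disjoint.
Qed.

(** Each endpoint is reached by at most one map, so it suffices to go beyond these at most two
    indices. *)
Lemma iIFS_eventually_inside : exists M : nat,
  forall v x, (M <= v)%N -> 0 <= x <= 1 -> 0 < f v x < 1.
Proof.
have avoid c : (c = 0) \/ (c = 1) -> exists M : nat, (0 < M)%N /\
    forall v x, (M <= v)%N -> 0 <= x <= 1 -> f v x != c.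
  move=> c01.
  have [[v0 [v00 [x0 x001 fx0]]]|no] :=
    pselect (exists v0, (0 < v0)%N /\ exists2 x, 0 <= x <= 1 & f v0 x = c).
    exists v0.+1; split => // v x vv x01; apply/eqP => fx.
    have v0' : (0 < v)%N by apply: leq_trans vv.
    have := iIFS_endpoint_unique c01 v00 v0' x001 x01 fx0 fx.
    by move=> e; rewrite e ltnn in vv.
  exists 1%N; split => // v x v0 x01; apply/eqP => fx; apply: no.
  by exists v; split => //; exists x.
have [M0 [M00 H0]] := avoid 0 (or_introl erefl).
have [M1 [M10 H1]] := avoid 1 (or_intror erefl).
exists (maxn M0 M1) => v x; rewrite geq_max => /andP[v0 v1] x01.
have /andP[f0 f1] := iIFS_maps f_iIFS (leq_trans M00 v0) x01.
by rewrite !lt_neqAle f0 f1 eq_sym (H0 v x v0 x01) (H1 v x v1 x01).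
Qed.

Lemma digit_shift_shift m n a :
  digit_shift m (digit_shift n a) = digit_shift (m + n) a.
Proof. by apply/funext => i; rewrite /digit_shift addnA. Qed.

Lemma natural_proj_shiftS n a : pos_digits a ->
  natural_proj f (digit_shift n a) =
  f (a n.+1) (natural_proj f (digit_shift n.+1 a)).
Proof.
move=> pa; rewrite (natural_projS f_iIFS xi_gt0 f_regular).
  by rewrite digit_shift_shift.
exact: pos_digits_shift.
Qed.

(** Backward induction: a late digit sends [0,1] into (0,1), and every earlier map, being strictly
    monotone into [0,1], sends (0,1) into itself. *)
Lemma natural_proj_interior (M N : nat) a n : pos_digits a ->
  (forall v x, (M <= v)%N -> 0 <= x <= 1 -> 0 < f v x < 1) ->
  (forall i, (N <= i)%N -> (M <= a i)%N) ->
  0 < natural_proj f (digit_shift n a) < 1.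
Proof.
move=> pa HM HN.
have p01 k : 0 <= natural_proj f (digit_shift k a) <= 1.
  by apply: (natural_proj01 f_iIFS xi_gt0 f_regular); exact: pos_digits_shift.
have [k] : exists k, (N <= n + k)%N by exists N; rewrite leq_addl.
elim: k n => [|k IH] n Nk; rewrite natural_proj_shiftS//.
  by apply: HM => //; apply: HN; rewrite addn0 in Nk; exact: leqW.
rewrite addnS -addSn in Nk; have y01 := IH _ Nk.
have [b [L [b0 _ H]]] := iIFS_bilip f_iIFS xi_gt0 f_regular (pa n.+1 isT).
have m0 := iIFS_maps f_iIFS (pa n.+1 isT) (introT andP (conj (lexx 0) ler01)).
have m1 := iIFS_maps f_iIFS (pa n.+1 isT) (introT andP (conj ler01 (lexx 1))).
by have [[]|[]] := bilip01_mono b0 H y01; move: m0 m1; lra.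
Qed.

(** As the tails of [a] are interior, a different digit of [b] would put the points at positive
    distance by [bilip01_separated]. Once the digits agree, injectivity passes the equality on to
    the next tails. *)
Lemma natural_proj_unique a b : pos_digits a -> pos_digits b ->
  (forall n, 0 < natural_proj f (digit_shift n a) < 1) ->
  natural_proj f a = natural_proj f b -> forall n, (0 < n)%N -> a n = b n.
Proof.
move=> pa pb ain ab.
have p01 k c : pos_digits c -> 0 <= natural_proj f (digit_shift k c) <= 1.
  move=> pc; apply: (natural_proj01 f_iIFS xi_gt0 f_regular).
  exact: pos_digits_shift.
have step n : natural_proj f (digit_shift n a) =
    natural_proj f (digit_shift n b) -> a n.+1 = b n.+1 /\
    natural_proj f (digit_shift n.+1 a) = natural_proj f (digit_shift n.+1 b).
  rewrite (natural_proj_shiftS n pa) (natural_proj_shiftS n pb) => e.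
  have [L1 [L2 [L10 _ H]]] := iIFS_bilip f_iIFS xi_gt0 f_regular (pa n.+1 isT).
  have abn : a n.+1 = b n.+1.
    apply: contrapT => ne.
    have [L1' [L2' [L10' _ H']]] :=
      iIFS_bilip f_iIFS xi_gt0 f_regular (pb n.+1 isT).
    have dis s t : 0 < s < 1 -> 0 < t < 1 -> f (a n.+1) s <> f (b n.+1) t.
      by apply: iIFS_disjoint => //; [exact: pa|exact: pb].
    have := bilip01_separated L10 H L10' H' dis (ain n.+1) (p01 n.+1 b pb).
    rewrite e subrr normr0 pmulr_rle0// leNgt lt_min subr_gt0.
    by rewrite (ain n.+1).
  split => //; rewrite -abn in e.
  by apply: (bilip01_inj L10 H) => //; rewrite in_itv /= p01.
have all n : natural_proj f (digit_shift n a) = natural_proj f (digit_shift n b).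
  elim: n => [|n IH]; last exact: (step _ IH).2.
  have s0 c : digit_shift 0 c = c.
    by apply/funext => i; rewrite /digit_shift addn0.
  by rewrite !s0.
by case=> // n _; exact: (step n (all n)).1.
Qed.

Variables (B L : nat -> R).
Hypothesis B_gt0 : forall v, (0 < v)%N -> 0 < B v.
Hypothesis B_bilip : forall v, (0 < v)%N -> bilip01 (B v) (L v) (f v).

Lemma comp_word_expand n a x y : pos_digits a -> 0 <= x <= 1 -> 0 <= y <= 1 ->
  (\prod_(i < n) B (a i.+1)) * `|x - y| <=
  `|comp_word f (digit_prefix a n) x - comp_word f (digit_prefix a n) y|.
Proof.
elim: n a => [|n IH] a pa x01 y01; first by rewrite big_ord0 mul1r.
have ps := pos_digits_shift 1 pa.
rewrite digit_prefixS /= big_ord_recl -mulrA.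
have Hx := comp_word_maps f_iIFS (pos_digits_prefix n ps) x01.
have Hy := comp_word_maps f_iIFS (pos_digits_prefix n ps) y01.
have /andP[+ _] := B_bilip (pa 1%N isT) Hx Hy.
apply: le_trans; rewrite ler_pM2l ?B_gt0//; last exact: pa.
apply: le_trans (IH _ ps x01 y01); rewrite le_eqVlt; apply/orP; left; apply/eqP.
by congr (_ * _); apply: eq_bigr => i _; rewrite /digit_shift addn1.
Qed.

(** Removing the common prefix costs the product of the lower constants; the maps of the first
    differing digits are then separated by [bilip01_separated], with [d] as the margin of the tail
    of [a]. *)
Lemma natural_proj_first_difference n a b (d : R) :
  pos_digits a -> pos_digits b ->
  (forall i, (0 < i <= n)%N -> a i = b i) -> a n.+1 <> b n.+1 ->
  0 < d -> d <= natural_proj f (digit_shift n.+1 a) <= 1 - d ->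
  (\prod_(i < n) B (a i.+1)) * (B (a n.+1) * d) <=
  `|natural_proj f a - natural_proj f b|.
Proof.
move=> pa pb ab abn d0 ad.
have p01 k c : pos_digits c -> 0 <= natural_proj f (digit_shift k c) <= 1.
  move=> pc; apply: (natural_proj01 f_iIFS xi_gt0 f_regular).
  exact: pos_digits_shift.
rewrite (natural_proj_prefix f_iIFS xi_gt0 f_regular n pa).
rewrite (natural_proj_prefix f_iIFS xi_gt0 f_regular n pb).
have -> : digit_prefix b n = digit_prefix a n.
  apply/eq_in_map => i; rewrite mem_iota add1n ltnS => /ab; exact: esym.
apply: le_trans (comp_word_expand _ pa (p01 n a pa) (p01 n b pb)).
rewrite ler_wpM2l//.
  by apply: prodr_ge0 => i _; apply/ltW/B_gt0/pa.
rewrite (natural_proj_shiftS n pa) (natural_proj_shiftS n pb).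
have dis s t : 0 < s < 1 -> 0 < t < 1 -> f (a n.+1) s <> f (b n.+1) t.
  by apply: iIFS_disjoint => //; [exact: pa|exact: pb].
have x01 : 0 < natural_proj f (digit_shift n.+1 a) < 1 by move: ad; lra.
apply: le_trans (bilip01_separated (B_gt0 (pa n.+1 isT)) (B_bilip (pa n.+1 isT))
  (B_gt0 (pb n.+1 isT)) (B_bilip (pb n.+1 isT)) dis x01 (p01 n.+1 b pb)).
rewrite ler_pM2l; last exact/B_gt0/pa.
by rewrite le_min; move: ad; lra.
Qed.

End uniqueness_of_digits.

(** * Hausdorff content and its relation to Hausdorff measure *)

Section hausdorff_content.
Variable R : realType.
Implicit Types (A U : set R) (s L e : R) (h : R -> R).
Local Open Scope ereal_scope.

Lemma diam_pow_ge0 s U : 0 <= diam_pow s U.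
Proof. by rewrite /diam_pow; case: ifPn => // _; exact: poweR_ge0. Qed.

Lemma diam_pow0 s : diam_pow s (@set0 R) = 0.
Proof. by rewrite /diam_pow eqxx. Qed.

Lemma dist_le_diam U x y : U x -> U y -> `|x - y|%:E <= diam U.
Proof. by move=> Ux Uy; apply: ereal_sup_ubound; exists (x, y). Qed.

Lemma diam_ge0 U : U !=set0 -> 0 <= diam U.
Proof.
by move=> [x Ux]; have := dist_le_diam Ux Ux; rewrite subrr normr0.
Qed.

Lemma le_poweR s (x y : \bar R) : (0 <= s)%R -> 0 <= x -> x <= y ->
  x `^ s <= y `^ s.
Proof.
move=> s0 x0 xy; apply: (gt0_ler_poweR s0) => //; rewrite in_itv /= leey andbT//.
exact: le_trans xy.
Qed.

Lemma le_diam_pow s U V : (0 <= s)%R -> U `<=` V ->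
  diam_pow s U <= diam_pow s V.
Proof.
move=> s0 UV; rewrite {1}/diam_pow; case: ifPn => [_|/set0P[x Ux]].
  exact: diam_pow_ge0.
have V0 : V != set0 by apply/set0P; exists x; exact: UV.
rewrite /diam_pow (negPf V0) le_poweR//; first by apply: diam_ge0; exists x.
apply: ereal_sup_le => _ [[u v] /= [/UV Vu /UV Vv] <-].
by exists (u, v).
Qed.

Lemma diam_pow_lipschitz_image s L h U : (0 <= s)%R -> (0 < L)%R ->
  (forall x y, U x -> U y -> `|h x - h y| <= L * `|x - y|)%R ->
  diam_pow s (h @` U) <= (L `^ s)%:E * diam_pow s U.
Proof.
move=> s0 L0 hL; have [->|/set0P U0] := eqVneq U set0.
  by rewrite image_set0 diam_pow0 mule0.
rewrite /diam_pow !ifN; last 2 first.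
- by apply/set0P.
- by apply/set0P; case: U0 => x Ux; exists (h x), x.
have hU0 : (h @` U) !=set0 by case: U0 => x Ux; exists (h x), x.
have le : diam (h @` U) <= L%:E * diam U.
  apply: ge_ereal_sup => _ [[u v] /= [[x Ux <-] [y Uy <-]] <-].
  apply: (@le_trans _ _ (L * `|x - y|)%:E); first by rewrite lee_fin hL.
  by rewrite EFinM lee_pmul2l ?lte_fin// dist_le_diam.
have L0' : 0 <= L%:E by rewrite lee_fin ltW.
rewrite -[(L `^ s)%:E]/(L%:E `^ s) -(poweRM _ L0' (diam_ge0 U0)).
exact: (le_poweR s0 (diam_ge0 hU0) le).
Qed.

(* [mu_ext] only takes covers by measurable sets; declaring every set of reals
   measurable makes this the unrestricted Hausdorff content. *)
Definition hausdorff_content s A : \bar R :=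
  mu_ext (diam_pow s : set (g_sigma_algebraType [set: set R]) -> \bar R) A.

Lemma hausdorff_contentE s A : hausdorff_content s A =
  ereal_inf [set \sum_(i <oo) diam_pow s (U i) |
             U in [set U : nat -> set R | A `<=` \bigcup_i U i]].
Proof.
rewrite /hausdorff_content /mu_ext; congr ereal_inf; apply/seteqP.
split=> _ [U AU <-]; exists U => //; first by case: AU.
by split => // i; exact: sub_sigma_algebra.
Qed.

Lemma hausdorff_content_ge0 s A : 0 <= hausdorff_content s A.
Proof. by apply: mu_ext_ge0; exact: diam_pow_ge0. Qed.

Lemma le_hausdorff_content s A B : A `<=` B ->
  hausdorff_content s A <= hausdorff_content s B.
Proof. by rewrite /hausdorff_content => AB; apply: le_mu_ext. Qed.

Lemma hausdorff_content_bigcup s (A : nat -> set R) :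
  hausdorff_content s (\bigcup_n A n) <= \sum_(n <oo) hausdorff_content s (A n).
Proof. by apply: mu_ext_sigma_subadditive; exact: diam_pow_ge0. Qed.

Lemma hausdorff_content_set0 s : hausdorff_content s set0 = 0.
Proof. by apply: mu_ext0; [exact: diam_pow0|exact: diam_pow_ge0]. Qed.

Lemma hausdorff_content_lipschitz_image s L h A : (0 <= s)%R -> (0 < L)%R ->
  (forall x y, A x -> A y -> `|h x - h y| <= L * `|x - y|)%R ->
  hausdorff_content s (h @` A) <= (L `^ s)%:E * hausdorff_content s A.
Proof.
move=> s0 L0 hL; rewrite !hausdorff_contentE -ereal_inf_pZl ?powR_gt0//.
apply: le_ereal_inf_tmp => _ [_ [U AU <-] <-].
(* The members of the cover are cut down to [A], where the Lipschitz bound holds. *)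
apply: (@le_trans _ _ (\sum_(i <oo) diam_pow s (h @` (U i `&` A)))).
  apply: ereal_inf_lbound; exists (fun i => h @` (U i `&` A)) => //.
  by move=> _ [x Ax <-]; have [i _ Uix] := AU x Ax; exists i => //; exists x.
rewrite -nneseriesZl; last by move=> i _; exact: diam_pow_ge0.
apply: lee_nneseries => [i _ _|i _]; first exact: diam_pow_ge0.
apply: (le_trans (diam_pow_lipschitz_image s0 L0 _)).
  by move=> x y [_ Ax] [_ Ay]; exact: hL.
rewrite lee_pmul2l ?lte_fin ?powR_gt0//.
by apply: le_diam_pow.
Qed.

Lemma hausdorff_content_le1 s A : (0 <= s)%R ->
  (forall x, A x -> 0 <= x <= 1)%R -> hausdorff_content s A <= 1.
Proof.
move=> s0 A01; rewrite hausdorff_contentE.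
pose U (i : nat) : set R := if i == 0%N then [set x | 0 <= x <= 1]%R else set0.
apply: ge_ereal_inf; exists (\sum_(i <oo) diam_pow s (U i)).
  by exists U => // x /A01 x01; exists 0%N.
rewrite (nneseriesD1 (n := 0%N))//; last by move=> i _; exact: diam_pow_ge0.
rewrite eseries0 ?adde0 /=; last first.
  by move=> i _ /= /negPf i0; rewrite /U i0 diam_pow0.
rewrite /U /= /diam_pow; case: ifPn => [_|n0]; first by rewrite lee_fin ler01.
rewrite -[leRHS](poweR1r s) le_poweR//; first exact/diam_ge0/set0P.
apply: ge_ereal_sup => _ [[x y] /= [x01 y01] <-].
by rewrite lee_fin ler_norml; move: x01 y01; lra.
Qed.

Lemma hausdorff_content0_measure0 s A : (0 < s)%R ->
  hausdorff_content s A = 0 -> hausdorff_measure s A = 0.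
Proof.
move=> s0 A0; have pre_ge0 d : 0 <= hausdorff_premeasure s d A.
  apply: le_ereal_inf_tmp => _ [U _ <-].
  by apply: nneseries_ge0 => i _ _; exact: diam_pow_ge0.
have pre0 d : (0 < d)%R -> hausdorff_premeasure s d A = 0.
  move=> d0; apply/eqP; rewrite eq_le pre_ge0 andbT.
  apply/lee_addgt0Pr => e e0; rewrite add0e.
  pose e' := Num.min e (d `^ s)%R.
  have e'0 : (0 < e')%R by rewrite lt_min e0 powR_gt0.
  have := A0; rewrite hausdorff_contentE => A0'.
  have : ereal_inf [set \sum_(i <oo) diam_pow s (U i) |
      U in [set U : nat -> set R | A `<=` \bigcup_i U i]] < e'%:E.
    by rewrite A0' lte_fin.
  move=> /ereal_inf_lt[_ [U AU <-] Ue].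
  apply: ge_ereal_inf; exists (\sum_(i <oo) diam_pow s (U i)).
    exists U => //; split => // i.
    (* The diameter of the empty set is [-oo], a supremum over no distances. *)
    have [U0|U0] := eqVneq (U i) set0.
      by apply: ge_ereal_sup => z [[x y] [+ _]]; rewrite U0.
    rewrite leNgt; apply/negP => dU.
    have dd : (d `^ s)%:E <= diam_pow s (U i).
      rewrite /diam_pow (negPf U0) -poweR_EFin.
      by rewrite le_poweR// ?lee_fin ltW.
    have dS : diam_pow s (U i) <= \sum_(i <oo) diam_pow s (U i).
      rewrite (nneseriesD1 (n := i))//; last by move=> j _; exact: diam_pow_ge0.
      by rewrite leeDl// nneseries_ge0// => j _ _; exact: diam_pow_ge0.
    have := le_lt_trans (le_trans dd dS) Ue.
    by rewrite lte_fin lt_min ltxx andbF.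
  by apply: ltW; apply: (lt_le_trans Ue); rewrite lee_fin ge_min lexx.
apply/eqP; rewrite eq_le; apply/andP; split.
  by apply: ge_ereal_sup => _ [d /= d0 <-]; rewrite pre0.
by apply: (@le_trans _ _ (hausdorff_premeasure s 1 A)) => //;
  apply: ereal_sup_ubound; exists 1%R => //=.
Qed.

Lemma hausdorff_measure0_cover s A e : hausdorff_measure s A = 0 -> (0 < e)%R ->
  exists2 U : nat -> set R, A `<=` \bigcup_i U i &
    \sum_(i <oo) diam_pow s (U i) < e%:E.
Proof.
move=> A0 e0.
have : hausdorff_premeasure s 1 A < e%:E.
  apply: (@le_lt_trans _ _ (hausdorff_measure s A)).
    by apply: ereal_sup_ubound; exists 1%R => //=.
  by rewrite A0 lte_fin.
by move=> /ereal_inf_lt[_ [U [AU _] <-] Ue]; exists U.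
Qed.

End hausdorff_content.

(** * The upper bound for the dimension *)

Section upper_bound.
Variables (R : realType) (f : nat -> R -> R) (xi : nat -> R).
Hypothesis f_iIFS : is_iIFS f.
Hypothesis xi_gt0 : forall n, (0 < n)%N -> 0 < xi n.
Hypothesis f_regular : is_regular f xi.

Lemma comp_word_lipschitz w : pos_word w -> exists2 L : R, 0 < L &
  forall x y, 0 <= x <= 1 -> 0 <= y <= 1 ->
    `|comp_word f w x - comp_word f w y| <= L * `|x - y|.
Proof.
elim: w => [_|k w IH /andP[k0 w0]] /=.
  by exists 1 => // x y _ _; rewrite mul1r.
have [b [L [_ L0 H]]] := iIFS_bilip f_iIFS xi_gt0 f_regular k0.
have [L' L'0 H'] := IH w0.
exists (L * L'); first exact: mulr_gt0.
move=> x y x01 y01; have /andP[_ /le_trans] := H _ _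
  (comp_word_maps f_iIFS w0 x01) (comp_word_maps f_iIFS w0 y01); apply.
by rewrite -mulrA ler_pM2l//; exact: H'.
Qed.

Lemma esum_tail_small (D : set nat) (u : nat -> R) (e : R) :
  (forall n, D n -> 0 <= u n) -> (\esum_(n in D) (u n)%:E < +oo)%E -> 0 < e ->
  exists M : nat, (\sum_(M <= n <oo) (if n \in D then (u n)%:E else 0) < e%:E)%E.
Proof.
move=> u0; have v0 n : (0 <= if n \in D then (u n)%:E else 0)%E.
  by case: ifPn => // /set_mem /u0; rewrite lee_fin.
rewrite esum_mkcond -nneseries_esumT// => /nneseries_tail_cvg/(_ (fun n _ => v0 n)).
move=> /fine_cvgP[fin /cvgrPdist_lt tail] e0.
have {}tail := tail e e0; near \oo => M; exists M.
rewrite -[ltLHS]fineK; last by near: M.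
rewrite lte_fin.
have : `|0 - fine (\sum_(M <= k <oo) (if k \in D then (u k)%:E else 0))| < e.
  by near: M.
by rewrite sub0r normrN ltr_norml => /andP[].
Unshelve. all: by end_near. Qed.

(** Subadditivity bounds the content of [F] by half of itself; since [F] lies in [0,1] its content
    is finite, so it must vanish. *)
Lemma hausdorff_content_fixpoint0 (s : R) (D : set nat) (L : nat -> R)
    (F : set R) (M : nat) : 0 <= s -> (forall n, D n -> (0 < n)%N) ->
  (forall n, (0 < n)%N -> 0 < L n) ->
  (forall n, (0 < n)%N -> forall x y, 0 <= x <= 1 -> 0 <= y <= 1 ->
    `|f n x - f n y| <= L n * `|x - y|) ->
  (forall x, F x -> 0 <= x <= 1) ->
  F `<=` \bigcup_(n in [set n | D n /\ (M <= n)%N]) (f n @` F) ->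
  (\sum_(M <= n <oo) (if n \in D then (L n `^ s)%:E else 0) < (2^-1)%:E)%E ->
  hausdorff_content s F = 0%E.
Proof.
move=> s0 D0 L0 HL F01 FU tail.
have C0 := hausdorff_content_ge0 s F.
have C1 := hausdorff_content_le1 s0 F01.
have term0 n : (0 <= if n \in D then (L n `^ s)%:E else 0)%E.
  by case: ifPn => // _; rewrite lee_fin powR_ge0.
have Cfin : hausdorff_content s F \is a fin_num.
  by rewrite ge0_fin_numE// (le_lt_trans C1)// ltry.
have : (hausdorff_content s F <= (2^-1)%:E * hausdorff_content s F)%E.
  pose A n := if (M <= n)%N && (n \in D) then f n @` F else set0.
  apply: (@le_trans _ _ (hausdorff_content s (\bigcup_n A n))).
    apply: le_hausdorff_content => x /FU[n [Dn Mn] Fx]; exists n => //.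
    by rewrite /A Mn mem_set.
  apply: (le_trans (hausdorff_content_bigcup s A)).
  apply: (@le_trans _ _ (\sum_(n <oo | (M <= n)%N)
      (hausdorff_content s F * if n \in D then (L n `^ s)%:E else 0)))%E.
    rewrite [leRHS]eseries_mkcond; apply: lee_nneseries => n _.
      by rewrite hausdorff_content_ge0.
    rewrite /A; case: (M <= n)%N => /=; last by rewrite hausdorff_content_set0.
    case: ifPn => [/set_mem Dn|_]; last by rewrite hausdorff_content_set0 mule0.
    rewrite muleC; apply: hausdorff_content_lipschitz_image => //.
      exact/L0/D0.
    by move=> x y /F01 x01 /F01 y01; apply: HL => //; exact: D0.
  rewrite -(eseries_cond _ xpredT) -(fineK Cfin) nneseriesZl//.
  by rewrite muleC lee_wpmul2r// ?fineK// ltW.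
move: C0 C1; rewrite -(fineK Cfin) -EFinM !lee_fin => C0 C1 le2.
by congr (_%:E); lra.
Qed.

Variable dig : R -> nat -> nat.
Hypothesis dig_digits : is_digits f dig.

Lemma hausdorff_measure_upper (D : set nat) (s' s : R) (T : set R) :
  (forall k, D k -> (0 < k)%N) -> 0 <= s' -> s' < s ->
  (\esum_(n in D) (1 / xi n `^ s')%:E < +oo)%E ->
  T `<=` digits_to_infty f dig D -> hausdorff_measure s T = 0%E.
Proof.
move=> D0 s'0 s's sum TE.
have s0 : 0 < s by apply: le_lt_trans s's.
(* With this choice [(1 - eps) * s = s'], so the [s]-th powers of the Lipschitz constants are
   multiples of the terms of the convergent series. *)
pose eps := 1 - s' / s.
have eps0 : 0 < eps by rewrite subr_gt0 ltr_pdivrMr// mul1r.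
have [c1 [c2 [c10 c20 H]]] := regular_bilip f_iIFS f_regular eps0.
pose L n := c2 / xi n `^ (1 - eps).
have L0 n : (0 < n)%N -> 0 < L n.
  by move=> n0; rewrite divr_gt0// powR_gt0// xi_gt0.
have Ls n : (0 < n)%N -> L n `^ s = c2 `^ s * (1 / xi n `^ s').
  move=> n0; rewrite /L powRM ?(ltW c20) ?invr_ge0 ?powR_ge0//.
  rewrite -[in LHS]powRN -powRrM div1r -powRN; congr (_ * _ `^ _).
  by rewrite /eps subKr mulNr divfK// gt_eqF.
have [M tail] : exists M : nat,
    (\sum_(M <= n <oo) (if n \in D then (L n `^ s)%:E else 0) < (2^-1)%:E)%E.
  have [||M HM] := esum_tail_small (e := 2^-1 / c2 `^ s) _ sum.
  - by move=> n _; rewrite div1r invr_ge0 powR_ge0.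
  - by rewrite divr_gt0// powR_gt0.
  exists M; rewrite (eq_eseriesr (g := fun n =>
    ((c2 `^ s)%:E * if n \in D then (1 / xi n `^ s')%:E else 0)%E)); last first.
    move=> n _; case: ifPn => [/set_mem Dn|_]; last by rewrite mule0.
    by rewrite Ls ?EFinM//; exact: D0.
  rewrite nneseriesZl; last first.
    by move=> n _; case: ifPn => // _; rewrite lee_fin div1r invr_ge0 powR_ge0.
  by rewrite muleC -lte_pdivlMr ?powR_gt0// -EFinM.
pose F := [set natural_proj f a |
  a in [set a | pos_digits a /\ forall n, (0 < n)%N -> D (a n) /\ (M <= a n)%N]].
have F01 x : F x -> 0 <= x <= 1.
  by move=> [a [pa _] <-]; exact: (natural_proj01 f_iIFS xi_gt0 f_regular).
have CF : hausdorff_content s F = 0%E.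
  apply: (@hausdorff_content_fixpoint0 s D L F M) => //; first exact: ltW.
    by move=> n n0 x y x01 y01; have /andP[] := H n n0 x y x01 y01.
  move=> _ [a [pa aD] <-]; exists (a 1%N); first exact: aD.
  exists (natural_proj f (digit_shift 1 a)).
    exists (digit_shift 1 a) => //; split; first exact: pos_digits_shift.
    by move=> n n0; apply: aD; rewrite addn_gt0 n0.
  by rewrite -(natural_projS f_iIFS xi_gt0 f_regular pa).
apply: hausdorff_content0_measure0 => //.
apply/eqP; rewrite eq_le hausdorff_content_ge0 andbT.
(* Finite words are enumerated by [pickle]; each contributes one copy of [F], and a point is placed
   by the prefix after which all its digits are at least [M]. *)
pose W k := if (unpickle k : option (seq nat)) is Some w then
  if pos_word w then comp_word f w @` F else set0 else set0.
apply: (@le_trans _ _ (hausdorff_content s (\bigcup_k W k))).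
  apply: le_hausdorff_content => x /TE[xA xD xoo].
  have [pd xE] := dig_digits xA.
  have [N _ HN] : \forall n \near \oo, (M <= dig x n)%N.
    by move/cvgnyPge: xoo => /(_ M).
  exists (pickle (digit_prefix (dig x) N)) => //.
  rewrite /W pickleK pos_digits_prefix//.
  exists (natural_proj f (digit_shift N (dig x))).
    exists (digit_shift N (dig x)) => //; split; first exact: pos_digits_shift.
    move=> n n0; split; first by apply: xD; rewrite addn_gt0 n0.
    by apply: HN => /=; rewrite leq_addl.
  by rewrite -(natural_proj_prefix f_iIFS xi_gt0 f_regular _ pd).
apply: (le_trans (hausdorff_content_bigcup s W)).
rewrite eseries0// => k _ _; apply/eqP; rewrite eq_le hausdorff_content_ge0 andbT.
rewrite /W; case: unpickle => [w|]; last by rewrite hausdorff_content_set0.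
case: ifPn => [w0|_]; last by rewrite hausdorff_content_set0.
have [Lw Lw0 HLw] := comp_word_lipschitz w0.
apply: (le_trans (hausdorff_content_lipschitz_image (ltW s0) Lw0 _)).
  by move=> x y /F01 x01 /F01 y01; exact: HLw.
by rewrite CF mule0.
Qed.

End upper_bound.

(** * Mass distribution on a tree of digit sequences *)

Section mass_distribution.
Variables (R : realType) (A : nat -> seq nat) (p : nat -> nat -> R).
Hypothesis A_uniq : forall i, uniq (A i).
Hypothesis p_ge0 : forall i v, 0 <= p i v.
Hypothesis p_mass : forall i, 1 <= \sum_(v <- A i) p i v.
Implicit Types (c a b : nat -> nat).

Definition tree_path c := forall i, c i \in A i.
(** By [p_mass] the children of a cylinder weigh together at least as much as the cylinder itself;
    this inequality stands in for the additivity of a measure. *)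
Definition cylinder_mass c n := \prod_(i < n) p i (c i).

Lemma tree_path_avoiding (a : nat -> nat -> nat) (N : nat -> nat) :
  (\sum_(i <oo) (cylinder_mass (a i) (N i))%:E < 1)%E ->
  exists2 c, tree_path c &
    forall i, ~ (forall j, (j < N i)%N -> c j = a i j).
Proof.
(* Invariant along the path [c] being built: the listed cylinders whose path
   agrees with the prefix [w] of [c], of any depth, have total mass less than
   [w]. Some child of [w] inherits it, and at a prefix of length [N i] it
   excludes the cylinder of [a i]. *)
move=> sum1; pose q i := cylinder_mass (a i) (N i).
have q0 i : 0 <= q i by apply: prodr_ge0.
pose V (w : seq nat) : \bar R :=
  (\sum_(i <oo) (if mkseq (a i) (size w) == w then (q i)%:E else 0))%E.
pose mass (w : seq nat) := \prod_(i < size w) p i (nth 0%N w i).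
pose inv w := (V w < (mass w)%:E)%E.
have term0 i (w : seq nat) n :
    (0 <= if mkseq (a i) n == w then (q i)%:E else 0)%E.
  by case: ifPn => // _; rewrite lee_fin.
have step w : exists v, inv w -> v \in A (size w) /\ inv (rcons w v).
  apply: contrapT => no.
  have invw : inv w.
    by apply: contrapT => ninv; apply: no; exists 0%N => /ninv.
  have big v : v \in A (size w) -> ((mass (rcons w v))%:E <= V (rcons w v))%E.
    by move=> vA; rewrite leNgt; apply/negP => lt; apply: no; exists v.
  have massS v : mass (rcons w v) = mass w * p (size w) v.
    rewrite /mass size_rcons big_ord_recr /= nth_rcons ltnn eqxx.
    by congr (_ * _); apply: eq_bigr => i _; rewrite nth_rcons ltn_ord.
  suff : ((mass w)%:E <= V w)%E by rewrite leNgt => /negP.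
  apply: (@le_trans _ _ (\sum_(v <- A (size w)) (mass (rcons w v))%:E)%E).
    rewrite sumEFin lee_fin; under eq_bigr do rewrite massS.
    rewrite -mulr_sumr ler_peMr//; exact: prodr_ge0.
  apply: (@le_trans _ _ (\sum_(v <- A (size w)) V (rcons w v))%E).
    by rewrite big_seq [leRHS]big_seq; apply: lee_sum => v; exact: big.
  rewrite -nneseries_sum//; apply: lee_nneseries => [i _ _|i _].
    by apply: sume_ge0.
  (* A listed path that agrees with [w] continues into at most one child, so its mass is counted at
     most once on the left. *)
  under eq_bigr do rewrite size_rcons mkseqS eqseq_rcons.
  case: eqP => _ /=; last by rewrite big1.
  have [aA|aA] := boolP (a i (size w) \in A (size w)); last first.
    rewrite big_seq big1 ?lee_fin// => v vA; case: eqP => // e.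
    by rewrite e vA in aA.
  rewrite (bigD1_seq (a i (size w)))//= eqxx big1 ?adde0// => v.
  by rewrite eq_sym => /negPf->.
have [next Hnext] := choice step.
pose W := fix W n := if n is k.+1 then rcons (W k) (next (W k)) else [::].
pose c n := next (W n).
have Wc n : W n = mkseq c n by elim: n => [//|n IH]; rewrite mkseqS -IH.
have sizeW n : size (W n) = n by rewrite Wc size_mkseq.
have invW n : inv (W n).
  elim: n => [|n IH] /=; last by case: (Hnext _ IH).
  by rewrite /inv /V /mass big_ord0.
exists c.
  by move=> n; case: (Hnext _ (invW n)) => + _; rewrite sizeW.
move=> i agree; have := invW (N i); rewrite /inv /V sizeW.
have -> : mass (W (N i)) = q i.
  rewrite /mass /q /cylinder_mass sizeW; apply: eq_bigr => j _.
  by rewrite Wc nth_mkseq// agree.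
apply/negP; rewrite -leNgt.
rewrite (nneseriesD1 (n := i))//=.
have -> : mkseq (a i) (N i) == W (N i).
  apply/eqP; rewrite Wc; apply/eq_in_map => j; rewrite mem_iota add0n => /= jN.
  exact/esym/agree.
by rewrite leeDl// nneseries_ge0.
Qed.

(** A lighter cover would have its members inside cylinders of total mass below 1/2 + 1/2, and
    [tree_path_avoiding] would yield a path whose point is not covered. *)
Lemma mass_distribution_principle (s C : R) (proj : (nat -> nat) -> R)
    (U : nat -> set R) : 0 <= s -> 0 < C ->
  (forall c e, tree_path c -> 0 < e -> exists n, cylinder_mass c n <= e) ->
  (forall a b n, tree_path a -> tree_path b ->
    (forall i, (i < n)%N -> a i = b i) -> a n <> b n ->
    cylinder_mass a n <= C * `|proj a - proj b| `^ s) ->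
  [set proj c | c in tree_path] `<=` \bigcup_i U i ->
  (((2 * C)^-1)%:E <= \sum_(i <oo) diam_pow s (U i))%E.
Proof.
move=> s0 C0 small sep cover; rewrite leNgt; apply/negP => lt.
(* If [n] is the first place where two paths into [U i] differ, these paths all
   lie in one cylinder of depth [n], of mass at most [C * diam (U i) `^ s]; the
   extra term takes care of a set [U i] met by at most one path. *)
have assign i : exists aN : (nat -> nat) * nat,
    ((cylinder_mass aN.1 aN.2)%:E <=
       C%:E * diam_pow s (U i) + (2^-1 / (2 ^ i.+1)%:R)%:E)%E /\
    forall c, tree_path c -> U i (proj c) ->
      forall j, (j < aN.2)%N -> c j = aN.1 j.
  have e0 : 0 < 2^-1 / (2 ^ i.+1)%:R :> R.
    by rewrite divr_gt0// ltr0n expn_gt0.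
  have CU0 : (0 <= C%:E * diam_pow s (U i))%E.
    by rewrite mule_ge0 ?diam_pow_ge0// lee_fin ltW.
  have deep a : tree_path a -> (forall c, tree_path c -> U i (proj c) -> c = a) ->
      exists aN : (nat -> nat) * nat,
    ((cylinder_mass aN.1 aN.2)%:E <=
       C%:E * diam_pow s (U i) + (2^-1 / (2 ^ i.+1)%:R)%:E)%E /\
    forall c, tree_path c -> U i (proj c) ->
      forall j, (j < aN.2)%N -> c j = aN.1 j.
    move=> ta uni; have [n na] := small a _ ta e0.
    exists (a, n); split => /=; last by move=> c tc /(uni _ tc) ->.
    by rewrite -[leLHS]add0e leeD// lee_fin.
  have A0 j : exists v, v \in A j.
    case: (A j) (p_mass j) => [|v l _]; first by rewrite big_nil ler10.
    by exists v; rewrite mem_head.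
  have [a0 a0P] := choice A0.
  have [[a [ta Ua]]|none] := pselect (exists a, tree_path a /\ U i (proj a)).
    have [ex|no] := pselect (exists n,
      `[< exists b, [/\ tree_path b, U i (proj b) & a n <> b n] >]); last first.
      apply: (deep a) => // c tc Uc; apply/funext => n; apply: contrapT => cn.
      by apply: no; exists n; apply/asboolP; exists c; split => // /esym.
    have [n /asboolP[b [tb Ub abn]] nmin] := ex_minnP ex.
    have agree c : tree_path c -> U i (proj c) -> forall j, (j < n)%N -> c j = a j.
      move=> tc Uc j jn; apply: contrapT => cj.
      have /nmin : `[< exists b, [/\ tree_path b, U i (proj b) & a j <> b j] >].
        by apply/asboolP; exists c; split => // /esym.
      by rewrite leqNgt jn.
    exists (a, n); split => //=.
    have Ui0 : U i != set0 by apply/set0P; exists (proj a).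
    have : (`|proj a - proj b| `^ s)%:E%E = (`|proj a - proj b|%:E `^ s)%E by [].
    move=> Eab; apply: (@le_trans _ _ (C%:E * diam_pow s (U i))%E); last first.
      by rewrite leeDl// lee_fin ltW.
    apply: (@le_trans _ _ (C * `|proj a - proj b| `^ s)%:E).
      by rewrite lee_fin sep// => j jn; rewrite -(agree b tb Ub).
    rewrite EFinM lee_pmul2l ?lte_fin// Eab /diam_pow (negPf Ui0).
    by rewrite le_poweR// ?lee_fin//; exact: dist_le_diam.
  (* No path enters [U i], so a deep cylinder around any path serves. *)
  apply: (deep a0 a0P) => c tc Uc; exfalso; apply: none; by exists c.
have [aN HaN] := choice assign.
have [|c tc Hc] := @tree_path_avoiding (fun i => (aN i).1) (fun i => (aN i).2).
  have half0 : (0 <= 2^-1 :> R) by rewrite invr_ge0.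
  apply: (@le_lt_trans _ _ (\sum_(i <oo)
    (C%:E * diam_pow s (U i) + (2^-1 / (2 ^ i.+1)%:R)%:E))%E).
    apply: lee_nneseries => [i _ _|i _]; last exact: (HaN i).1.
    by rewrite lee_fin; exact: prodr_ge0.
  (* The extra terms form a geometric series of sum 1/2. *)
  apply: (le_lt_trans (epsilon_trick _ _ half0)).
    by move=> i; rewrite mule_ge0 ?diam_pow_ge0// lee_fin ltW.
  rewrite nneseriesZl; last by move=> i _; exact: diam_pow_ge0.
  have : (C%:E * \sum_(i <oo) diam_pow s (U i) < (2^-1)%:E)%E.
    by rewrite muleC -lte_pdivlMr// -EFinM -invfM.
  move=> lt2; apply: (@lt_le_trans _ _ ((2^-1)%:E + (2^-1)%:E)%E).
    by rewrite lteD2rE.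
  by rewrite -EFinD lee_fin; lra.
have [i _ Ui] := cover (proj c) (ex_intro2 _ _ c tc erefl).
by apply: (Hc i) => j; exact: (HaN i).2.
Qed.

End mass_distribution.

(** Block [j] is encoded as [j.+1] and becomes available at stage [N j]; the value 0 means that no
    block is available yet. *)
Lemma slow_schedule (N : nat -> nat) : exists k : nat -> nat,
  [/\ forall n, (0 < k n)%N -> (N (k n).-1 <= n)%N,
      {homo k : m n / (m <= n)%N} &
      forall K, exists n0, forall n, (n0 <= n)%N -> (K <= k n)%N].
Proof.
pose k n := (\max_(j < n.+1 | N j <= n) j.+1)%N.
have kge n j : (j <= n)%N -> (N j <= n)%N -> (j < k n)%N.
  move=> jn Nj; have jn' : (j < n.+1)%N by [].
  exact: (@leq_bigmax_cond _ (fun j : 'I_n.+1 => N j <= n)%N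
    (fun j => j.+1) (Ordinal jn')).
exists k; split.
- move=> n; rewrite /k; elim/big_ind: _ => //.
    move=> x y IHx IHy; case: (leqP x y) => _; first exact: IHy.
    exact: IHx.
- move=> m n mn; apply/bigmax_leqP => j Nj; apply: kge.
    by apply: leq_trans mn; rewrite -ltnS.
  exact: leq_trans mn.
- move=> K; exists (maxn K (N K)) => n; rewrite geq_max => /andP[Kn NKn].
  exact/ltnW/kge.
Qed.

(** * Uniform positive bounds, and large finite blocks of a divergent series *)

Section positive_lower_bounds.
Variable R : realType.

Lemma common_positive (P : nat -> R -> Prop) (l : seq nat) :
  (forall v e e', P v e -> 0 < e' -> e' <= e -> P v e') ->
  (forall v, v \in l -> exists2 e, 0 < e & P v e) ->
  exists2 e, 0 < e & forall v, v \in l -> P v e.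
Proof.
move=> Pmono; elim: l => [_|v l IH H]; first by exists 1.
have [e e0 Pe] := H v (mem_head _ _).
have [|e' e'0 Pe'] := IH; first by move=> u ul; apply: H; rewrite inE ul orbT.
have m0 : 0 < Num.min e e' by rewrite lt_min e0.
exists (Num.min e e') => // u; rewrite inE => /predU1P[->|ul].
  by apply: Pmono Pe _ _; rewrite // ge_min lexx.
by apply: Pmono (Pe' u ul) _ _; rewrite // ge_min lexx orbT.
Qed.

(** The partial products are constant from [n0] on, so only finitely many positive values occur. *)
Lemma prod_eventually_one (r : nat -> R) n0 : (forall i, 0 < r i) ->
  (forall i, (n0 <= i)%N -> r i = 1) ->
  exists2 c, 0 < c & forall n, c <= \prod_(i < n) r i.
Proof.
move=> r0 r1; have P0 n : 0 < \prod_(i < n) r i by apply: prodr_gt0.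
have [||c c0 cP] := @common_positive (fun n e => e <= \prod_(i < n) r i)
    (iota 0 n0.+1).
- by move=> v e e' ev _ /le_trans; apply.
- by move=> v _; exists (\prod_(i < v) r i).
exists c => // n; have [nn0|n0n] := leqP n n0.
  by apply: cP; rewrite mem_iota.
rewrite -(subnKC (ltnW n0n)); elim: (n - n0)%N => [|k IH].
  by rewrite addn0; apply: cP; rewrite mem_iota add0n leqnn.
by rewrite addnS big_ord_recr /= r1 ?mulr1 ?leq_addr.
Qed.

(** Dropping the finitely many indices below [M] leaves a divergent series, whose finite subsums are
    unbounded. *)
Lemma esum_pinfty_block (D : set nat) (u : nat -> R) (M : nat) (K : R) :
  (forall n, 0 <= u n) -> (\esum_(n in D) (u n)%:E = +oo)%E ->
  exists l : seq nat, [/\ uniq l, forall v, v \in l -> D v /\ (M <= v)%N &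
    K <= \sum_(v <- l) u v].
Proof.
move=> u0 Doo.
have uE0 n : (0 <= (u n)%:E)%E by rewrite lee_fin.
have := esumID [set n | (M <= n)%N] D (fun n => (u n)%:E) (fun n _ => uE0 n).
rewrite Doo => /esym split_oo.
have finl : finite_set (D `&` ~` [set n | (M <= n)%N]).
  apply: (sub_finite_set _ (finite_II M)) => n /= [_ /negP].
  by rewrite -ltnNge.
have tail : (\esum_(n in D `&` [set n | (M <= n)%N]) (u n)%:E = +oo)%E.
  apply: contrapT => tail; move: split_oo.
  rewrite (esum_fset (F := D `&` ~` _))// fsbig_finite//= sumEFin.
  apply/eqP; rewrite lt_eqF// lte_add_pinfty ?ltry// ltNge leye_eq.
  exact/eqP.
have : (K%:E < \esum_(n in D `&` [set n | (M <= n)%N]) (u n)%:E)%E.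
  by rewrite tail ltry.
move=> /ereal_sup_gt[_ [X [finX XD] <-]].
rewrite fsbig_finite//= sumEFin lte_fin => /ltW KX.
exists (finmap.enum_fset (fset_set X)); split => //; first exact: finmap.fset_uniq.
by move=> v; rewrite in_fset_set// => /set_mem/XD.
Qed.

End positive_lower_bounds.

(** * The lower bound for the dimension *)

Section lower_bound.
Variables (R : realType) (f : nat -> R -> R) (xi : nat -> R).
Hypothesis f_iIFS : is_iIFS f.
Hypothesis xi_gt0 : forall n, (0 < n)%N -> 0 < xi n.
Hypothesis f_regular : is_regular f xi.

(** By monotonicity the extreme values of [f v] are taken at 0 and 1, so the margin is read off
    there. *)
Lemma inside_margin v : (0 < v)%N ->
  (forall x, 0 <= x <= 1 -> 0 < f v x < 1) ->
  exists2 e, 0 < e & forall x, 0 <= x <= 1 -> e <= f v x <= 1 - e.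
Proof.
move=> v0 ins; have [b [L [b0 _ H]]] := iIFS_bilip f_iIFS xi_gt0 f_regular v0.
have /andP[p0 p1] := ins 0 (introT andP (conj (lexx 0) ler01)).
have /andP[q0 q1] := ins 1 (introT andP (conj ler01 (lexx 1))).
pose e := Num.min (Num.min (f v 0) (f v 1)) (Num.min (1 - f v 0) (1 - f v 1)).
have [e1 e2 e3 e4] : [/\ e <= f v 0, e <= f v 1, e <= 1 - f v 0 & e <= 1 - f v 1].
  by rewrite /e !ge_min !lexx !orbT.
exists e; first by rewrite !lt_min p0 q0 !subr_gt0 p1.
move=> x /andP[]; rewrite le_eqVlt => /predU1P[<-|x0]; first by lra.
rewrite le_eqVlt => /predU1P[->|x1]; first by lra.
by have [[]|[]] := bilip01_mono b0 H (introT andP (conj x0 x1)); lra.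
Qed.

Variable dig : R -> nat -> nat.
Hypothesis dig_digits : is_digits f dig.

(** The digit [d0] is allowed everywhere and fills the positions before the first block becomes
    available; any other digit is allowed from some position on, so each finite block can be
    scheduled late enough. *)
Lemma hausdorff_measure_lower (D : set nat) (G : nat -> nat -> Prop) (d0 : nat)
    (s eps : R) (T : set R) :
  (forall k, D k -> (0 < k)%N) -> D d0 ->
  (forall k, (0 < k)%N -> G k d0) ->
  (forall v, D v -> exists N, forall k, (N <= k)%N -> G k v) ->
  0 <= s -> 0 < eps ->
  (\esum_(n in D) (1 / xi n `^ ((1 + eps) * s))%:E = +oo)%E ->
  [set x | digits_to_infty f dig D x /\
           forall k, (0 < k)%N -> G k (dig x k)] `<=` T ->
  hausdorff_measure s T <> 0%E.
Proof.
move=> D0 Dd0 Gd0 GD s0 eps0 sumoo subT.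
have [c1 [c2 [c10 c20 Hb]]] := regular_bilip f_iIFS f_regular eps0.
pose B n := c1 / xi n `^ (1 + eps).
have B0 v : (0 < v)%N -> 0 < B v.
  by move=> v0; rewrite divr_gt0// powR_gt0// xi_gt0.
have B1 v : (0 < v)%N -> B v <= 1.
  move=> v0; have i0 : 0 <= (0 : R) <= 1 by rewrite lexx ler01.
  have i1 : 0 <= (1 : R) <= 1 by rewrite lexx ler01.
  have /andP[+ _] := Hb v v0 0 1 i0 i1.
  rewrite sub0r normrN normr1 mulr1 => /le_trans; apply.
  have := iIFS_maps f_iIFS v0 i0; have := iIFS_maps f_iIFS v0 i1.
  by rewrite ler_norml; lra.
have Bs v : (0 < v)%N -> B v `^ s = c1 `^ s * (1 / xi v `^ ((1 + eps) * s)).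
  move=> v0; rewrite /B powRM ?(ltW c10) ?invr_ge0 ?powR_ge0//.
  by rewrite -[in LHS]powRN -powRrM div1r -powRN mulNr.
have [M inside] := iIFS_eventually_inside f_iIFS xi_gt0 f_regular.
(* The bound 4 pays for the division by 4 in the weights [p] below. *)
have block j : exists l : seq nat, [/\ uniq l,
    forall v, v \in l -> [/\ D v, (M <= v)%N & (j <= v)%N] &
    4 <= \sum_(v <- l) B v `^ s].
  have [|l [ul lD lK]] :=
      esum_pinfty_block (maxn M j) (4 / c1 `^ s) _ sumoo.
    by move=> n; rewrite div1r invr_ge0 powR_ge0.
  exists l; split => //.
    by move=> v /lD[Dv]; rewrite geq_max => /andP[].
  move: lK; rewrite ler_pdivrMr ?powR_gt0// => /le_trans; apply.
  rewrite mulrC mulr_sumr le_eqVlt; apply/orP; left; apply/eqP.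
  by apply: eq_big_seq => v /lD[/D0 v0 _]; rewrite Bs.
have [l lP] := choice block.
pose good v e := e <= B v /\ forall x, 0 <= x <= 1 -> e <= f v x <= 1 - e.
have margin j : exists e, 0 < e /\ forall v, v \in l j -> good v e.
  have [||e e0 eP] := @common_positive _ good (l j); last by exists e.
    move=> v e e' [eB ef] e'0 e'e; split; first exact: le_trans eB.
    by move=> x /ef; lra.
  move=> v vl; have [_ vD _] := lP j; have [Dv Mv _] := vD v vl.
  have v0 := D0 v Dv.
  have [e e0 ef] := inside_margin v0 (fun x => inside v x Mv).
  exists (Num.min e (B v)); first by rewrite lt_min e0 B0.
  split; first by rewrite ge_min lexx orbT.
  have me : Num.min e (B v) <= e by rewrite ge_min lexx.
  by move=> x /ef; lra.
have [e eP] := choice margin.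
have e0 j : 0 < e j by case: (eP j).
(* From this stage on, block [j] loses at most a factor [2^-1 ^+ n] in the estimates below; [n.+1]
   appears because stage [n] chooses digit [n.+1]. *)
have start j : exists N : nat, forall n, (N <= n)%N ->
    2^-1 ^+ n <= e j `^ s /\ forall v, v \in l j -> G n.+1 v.
  have h0 : 0 < 2^-1 :> R by rewrite invr_gt0.
  have h1 : 2^-1 < 1 :> R by rewrite invf_lt1// ltr1n.
  have [N1 HN1] := expr_small h0 h1 (powR_gt0 s (e0 j)).
  have [N2 HN2] : exists N2, forall v k, v \in l j -> (N2 <= k)%N -> G k v.
    have [_ lD _] := lP j.
    elim: (l j) lD => [_|v t IH H]; first by exists 0%N.
    have [|N2 HN2] := IH; first by move=> u ut; apply: H; rewrite inE ut orbT.
    have [Dv _ _] := H v (mem_head _ _); have [N3 HN3] := GD v Dv.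
    exists (maxn N2 N3) => u k; rewrite inE geq_max => /predU1P[->|ut] /andP[k2 k3].
      exact: HN3.
    exact: HN2.
  exists (maxn N1 N2) => n; rewrite geq_max => /andP[n1 n2]; split.
    apply: le_trans (ltW HN1); apply: ler_wiXn2l => //; exact: ltW.
  by move=> v vl; apply: HN2 => //; exact: leqW.
have [N NP] := choice start.
have [k [kN kmono koo]] := slow_schedule N.
(* While [k n = 0] the only digit is [d0], and [r n] gives it weight 1. *)
pose A n := if k n == 0%N then [:: d0] else l (k n).-1.
pose r n := if k n == 0%N then B d0 `^ s / 4 else 1.
pose p n v := B v `^ s / (4 * r n).
have d00 := D0 d0 Dd0.
have r0 n : 0 < r n by rewrite /r; case: ifP => // _; rewrite divr_gt0 ?powR_gt0 ?B0.
have A_uniq n : uniq (A n).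
  by rewrite /A; case: ifP => // _; case: (lP (k n).-1).
have p_ge0 n v : 0 <= p n v.
  by rewrite divr_ge0 ?powR_ge0// mulr_ge0// ltW.
have p_mass n : 1 <= \sum_(v <- A n) p n v.
  rewrite /p -mulr_suml ler_pdivlMr ?mulr_gt0// mul1r /A /r; case: ifP => _.
    by rewrite big_seq1 mulrC divfK.
  by rewrite mulr1; case: (lP (k n).-1).
have AD n v : v \in A n -> D v.
  rewrite /A; case: ifP => _; first by rewrite inE => /eqP->.
  by have [_ lD _] := lP (k n).-1; case/lD.
have [n0 n0P] := koo 1%N.
have kpos n : (n0 <= n)%N -> k n != 0%N by move=> /n0P; rewrite lt0n.
have [rc rc0 rcP] : exists2 c, 0 < c & forall n, c <= \prod_(i < n) r i.
  by apply: (prod_eventually_one (n0 := n0)) => // i /kpos/negPf ki; rewrite /r ki.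
(* Paths are indexed from 0 and digit sequences from 1. *)
pose digs (c : nat -> nat) : nat -> nat := fun n => c n.-1.
pose proj c := natural_proj f (digs c).
have digs_pos c : tree_path A c -> pos_digits (digs c).
  by move=> tc n _; exact/D0/(AD _ _ (tc n.-1)).
have late c n : tree_path A c -> (n0 <= n)%N -> (M <= c n)%N /\ ((k n).-1 <= c n)%N.
  move=> tc /kpos/negPf kn; have := tc n; rewrite /A kn.
  by have [_ lD _] := lP (k n).-1; case/lD.
have interior c n : tree_path A c -> 0 < natural_proj f (digit_shift n (digs c)) < 1.
  move=> tc; apply: (natural_proj_interior (N := n0.+1) f_iIFS xi_gt0 f_regular) => //.
  - exact: digs_pos.
  - exact: inside.
  - by case=> // i; rewrite ltnS => /(late c _ tc)[].
have massE c n : tree_path A c ->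
    cylinder_mass p c n = (\prod_(i < n) B (c i)) `^ s * 4^-1 ^+ n / \prod_(i < n) r i.
  move=> tc; rewrite /cylinder_mass; elim: n => [|n IH].
    by rewrite !big_ord0 powR1 expr0 invr1 !mulr1.
  rewrite !big_ord_recr /= IH powRM; last 2 first.
  - by apply: prodr_ge0 => i _; apply/ltW/B0/D0/(AD i).
  - by apply/ltW/B0/D0/(AD n).
  rewrite /p exprS; field; rewrite (gt_eqF (r0 n)) /= gt_eqF//.
  exact: prodr_gt0.
have mass_le c n : tree_path A c ->
    cylinder_mass p c n <= (\prod_(i < n) B (c i)) `^ s * 4^-1 ^+ n / rc.
  move=> tc; rewrite massE// ler_wpM2l ?mulr_ge0 ?powR_ge0 ?exprn_ge0//.
  by rewrite lef_pV2 ?posrE//; exact: prodr_gt0.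
(* The 2 makes up for [4^-1 ^+ n] against [2^-1 ^+ n * 2^-1 ^+ n.+1], and [rc] for the weights of
   the initial stages. *)
pose C := 2 / rc.
have C0 : 0 < C by rewrite divr_gt0.
have small c eta : tree_path A c -> 0 < eta -> exists n, cylinder_mass p c n <= eta.
  move=> tc eta0; have q0 : 0 < 4^-1 :> R by rewrite invr_gt0.
  have q1 : 4^-1 < 1 :> R by rewrite invf_lt1// ltr1n.
  have [n Hn] := expr_small q0 q1 (mulr_gt0 eta0 rc0).
  exists n; apply: le_trans (mass_le c n tc) _; rewrite ler_pdivrMr//.
  apply: le_trans (ltW Hn); rewrite ler_piMl ?exprn_ge0//.
  have P1 : \prod_(i < n) B (c i) <= 1.
    apply: prodr_ile1 => i _; rewrite (B1 _ (D0 _ (AD _ _ (tc i)))) andbT.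
    exact/ltW/B0/D0/(AD i).
  have P0 : 0 <= \prod_(i < n) B (c i).
    by apply: prodr_ge0 => i _; apply/ltW/B0/D0/(AD i).
  apply: (@le_trans _ _ (1 `^ s)); last by rewrite powR1.
  by rewrite ge0_ler_powR// nnegrE.
have sep a b n : tree_path A a -> tree_path A b ->
    (forall i, (i < n)%N -> a i = b i) -> a n <> b n ->
    cylinder_mass p a n <= C * `|proj a - proj b| `^ s.
  move=> ta tb ab abn.
  (* Before the first block the only letter is [d0], so two paths cannot differ there. *)
  have kn : k n != 0%N.
    apply/negP => kn; apply: abn; have := ta n; have := tb n.
    by rewrite /A kn !inE => /eqP-> /eqP->.
  have kSn : k n.+1 != 0%N.
    by rewrite -lt0n (leq_trans _ (kmono _ _ (leqnSn n)))// lt0n.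
  have [_ /(_ (a n))] := eP (k n).-1.
  have := ta n; rewrite /A (negPf kn) => -> /(_ isT) [eB _].
  have [_ /(_ (a n.+1))] := eP (k n.+1).-1.
  have := ta n.+1; rewrite /A (negPf kSn) => -> /(_ isT) [_ ef].
  have [Nn _] := NP _ _ (kN n (eqbRL (lt0n _) kn)).
  have [NSn _] := NP _ _ (kN n.+1 (eqbRL (lt0n _) kSn)).
  have pa := digs_pos a ta; have pb := digs_pos b tb.
  have := natural_proj_first_difference f_iIFS xi_gt0 f_regular (n := n) (a := digs a)
     (b := digs b) (d := e (k n.+1).-1) B0 Hb pa pb.
  rewrite -/(proj a) -/(proj b) /= => fd.
  have {}fd : (\prod_(i < n) B (a i)) * (B (a n) * e (k n.+1).-1) <= `|proj a - proj b|.
    apply: fd => //.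
      by case=> // i /= iN; exact: ab.
    (* The tail after [n.+1] digits lies in the image of the map with index [a n.+1], which keeps
       the margin of the block of stage [n.+1]. *)
    rewrite (natural_proj_shiftS f_iIFS xi_gt0 f_regular _ pa) /=; apply: ef.
    by apply: (natural_proj01 f_iIFS xi_gt0 f_regular); exact: pos_digits_shift.
  have an0 : 0 < B (a n) by apply/B0/D0/(AD n).
  have P0 : 0 <= \prod_(i < n) B (a i).
    by apply: prodr_ge0 => i _; apply/ltW/B0/D0/(AD i).
  have fds : (\prod_(i < n) B (a i)) `^ s * (2^-1 ^+ n * 2^-1 ^+ n.+1) <=
      `|proj a - proj b| `^ s.
    apply: (@le_trans _ _ ((\prod_(i < n) B (a i) * (B (a n) * e (k n.+1).-1)) `^ s)).
      rewrite (powRM _ P0 (mulr_ge0 (ltW an0) (ltW (e0 _)))).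
      rewrite (powRM _ (ltW an0) (ltW (e0 _))).
      rewrite ler_wpM2l ?powR_ge0// ler_pM ?exprn_ge0//.
      by apply: le_trans Nn _; apply: ge0_ler_powR => //; rewrite nnegrE ltW.
    by apply: ge0_ler_powR => //; rewrite nnegrE// mulr_ge0// mulr_ge0// ltW.
  apply: le_trans (mass_le a n ta) _.
  rewrite /C [leRHS]mulrAC ler_pM2r ?invr_gt0//.
  apply: (@le_trans _ _ (2 * ((\prod_(i < n) B (a i)) `^ s *
      (2^-1 ^+ n * 2^-1 ^+ n.+1)))); last by rewrite ler_pM2l.
  rewrite mulrCA ler_wpM2l ?powR_ge0// exprS.
  have -> : 4^-1 = 2^-1 * 2^-1 :> R by rewrite -invfM -natrM.
  rewrite exprMn le_eqVlt; apply/orP; left; apply/eqP; by field.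
move=> measure0.
have e'0 : 0 < (2 * C)^-1 by rewrite invr_gt0 mulr_gt0.
have [U TU] := hausdorff_measure0_cover measure0 e'0.
rewrite ltNge => /negP; apply.
apply: (mass_distribution_principle A_uniq p_ge0 p_mass s0 C0 small sep).
apply: subset_trans TU; apply: subset_trans subT.
move=> _ [c tc <-]; rewrite -/(proj c).
have pc := digs_pos c tc.
have xA : attractor f (proj c) by exists (digs c).
have [pd xE] := dig_digits xA.
(* Although [dig] is an arbitrary choice of expansion, this point has interior tails and hence only
   one expansion. *)
have digE n : (0 < n)%N -> dig (proj c) n = c n.-1.
  move=> n0'; apply/esym; apply: (natural_proj_unique f_iIFS xi_gt0 f_regular pc pd) => //.
  by move=> m; exact: interior.
split; last first.
  case=> // i _; rewrite digE//=; have := tc i; rewrite /A; case: ifPn => [_|ki].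
    by rewrite inE => /eqP->; exact: Gd0.
  have ki0 : (0 < k i)%N by rewrite lt0n.
  by move=> cl; have [_] := NP _ _ (kN i ki0); apply.
split => //.
  by move=> n n0'; rewrite digE//; exact/AD/tc.
(* At stage [n] the letters are at least [(k n).-1], so [K.+1] is needed to reach [K]. *)
apply/cvgnyPge => K; have [n1 n1P] := koo K.+1.
exists (maxn n0 n1).+1 => // n /=; case: n => // n; rewrite ltnS geq_max => /andP[nn0 nn1].
rewrite digE//=; have [_] := late c n tc nn0; apply: leq_trans.
by have := n1P n nn1; case: (k n).
Qed.

End lower_bound.

(** * The dimension formula and its application to the two sets *)

Lemma min_nat_in (D : set nat) : D !=set0 -> D (min_nat D).
Proof.
move=> [d Dd]; have exD : exists n, `[< D n >] by exists d; exact/asboolP.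
have [n /asboolP Dn nmin] := ex_minnP exD.
have [] // := @xgetPex _ 0%N [set d | D d /\ forall k, D k -> (d <= k)%N].
by exists n; split => // k Dk; apply: nmin; exact/asboolP.
Qed.

(* [G k v] says that the digit [v] is allowed at position [k]: both sets of the
   theorem contain a set of this form. *)
Lemma hausdorff_dim_eq_s0 (R : realType) (f : nat -> R -> R) (xi : nat -> R)
    (dig : R -> nat -> nat) (D : set nat) (G : nat -> nat -> Prop) (d0 : nat)
    (T : set R) :
  is_iIFS f -> (forall n, (0 < n)%N -> 0 < xi n) -> is_regular f xi ->
  is_digits f dig -> (forall k, D k -> (0 < k)%N) -> D d0 ->
  (forall k, (0 < k)%N -> G k d0) ->
  (forall v, D v -> exists N, forall k, (N <= k)%N -> G k v) ->
  T `<=` digits_to_infty f dig D ->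
  [set x | digits_to_infty f dig D x /\
           forall k, (0 < k)%N -> G k (dig x k)] `<=` T ->
  hausdorff_dim T = s0 D xi.
Proof.
move=> fI xi0 freg digP D0 Dd0 Gd0 GD TE ET.
apply/eqP; rewrite eq_le; apply/andP; split; apply: le_ereal_inf_tmp.
  move=> _ [s [s_ge0 sum] <-]; apply/lee_addgt0Pr => e e0.
  apply: ereal_inf_lbound; exists (s + e) => //; split.
    by rewrite addr_ge0// ltW.
  by apply: (hausdorff_measure_upper fI xi0 freg digP D0 s_ge0 _ sum TE);
    rewrite ltrDl.
move=> _ [s [s_ge0 measure0] <-]; rewrite leNgt; apply/negP => lt.
(* A real [r] is needed because [s0 D xi] may be infinite. *)
have [r sr rs0] : exists2 r : R, s < r & (r%:E <= s0 D xi)%E.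
  move: lt; case: (s0 D xi) => [r|_|//]; first by exists r.
  by exists (s + 1); rewrite ?ltrDl ?leey.
have s1 : 0 < s + 1 by rewrite ltr_wpDl.
(* This gives [(1 + eps) * s < r], hence divergence of the series at that exponent; the denominator
   [s + 1] also allows [s = 0]. *)
pose eps := (r - s) / (s + 1).
have eps0 : 0 < eps by rewrite divr_gt0// subr_gt0.
have eps_r : (1 + eps) * s < r.
  have -> : r = s + eps * (s + 1) by rewrite /eps divfK ?gt_eqF// addrC subrK.
  by rewrite mulrDl mul1r mulrDr mulr1 addrA ltrDl.
apply: (hausdorff_measure_lower fI xi0 freg digP D0 Dd0 Gd0 GD s_ge0 eps0 _ ET
  measure0).
apply/eqP; rewrite eq_le leey leNgt /=; apply/negP => fin.
have : (s0 D xi <= ((1 + eps) * s)%:E)%E.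
  apply: ereal_inf_lbound; exists ((1 + eps) * s) => //; split => //.
  by rewrite mulr_ge0// addr_ge0// ltW.
by move=> /(le_trans rs0); rewrite lee_fin leNgt eps_r.
Qed.

Theorem theorem1p3 (R : realType) (f : nat -> R -> R) (xi : nat -> R)
  (dig : R -> nat -> nat) (D : set nat) (m : nat)
  (t : 'I_m -> R) (g : 'I_m -> nat -> nat) (phi : nat -> R)
  (f_iIFS : is_iIFS f)
  (xi_gt0 : forall n, (0 < n)%N -> 0 < xi n)
  (f_regular : is_regular f xi)
  (f_bdp : bounded_distortion f)
  (dig_digits : is_digits f dig)
  (D_pos : forall k, D k -> (0 < k)%N)
  (D_infinite : infinite_set D)
  (m_gt0 : (0 < m)%N)
  (t_gt0 : forall i, 0 < t i)
  (g_pos : forall i n, (0 < n)%N -> (0 < g i n)%N)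
  (phi_ge : forall n, (0 < n)%N -> threshold D t <= phi n)
  (phi_infty : phi @ \oo --> +oo) :
  hausdorff_dim (digit_products_bounded f dig D phi t g) =
    hausdorff_dim (digits_bounded f dig D phi) /\
  hausdorff_dim (digits_bounded f dig D phi) = s0 D xi.
Proof.
have Dd0 := min_nat_in (infinite_setN0 D_infinite).
have d0_ge1 : 1 <= (min_nat D)%:R :> R by rewrite ler1n; exact: D_pos.
have mR0 : m%:R != 0 :> R by rewrite pnatr_eq0 -lt0n.
have phi_ge0 n : (0 < n)%N -> 0 <= phi n.
  by move=> /phi_ge; apply: le_trans; rewrite le_max ler0n.
have -> : hausdorff_dim (digits_bounded f dig D phi) = s0 D xi.
  apply: (hausdorff_dim_eq_s0 (G := fun k v => v%:R <= phi k)
    f_iIFS xi_gt0 f_regular dig_digits D_pos Dd0) => //.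
  - by move=> k /phi_ge; apply: le_trans; rewrite le_max lexx.
  - move=> v _; have /cvgryPge/(_ v%:R)[N _ HN] := phi_infty.
    by exists N => k Nk; exact: HN.
  - by move=> x [].
split => //.
(* The bound on a product of [m] factors is replaced by the stronger demand that the [m]-th power of
   each factor be at most [phi n]. *)
apply: (hausdorff_dim_eq_s0 (G := fun k v => forall n i, (0 < n)%N ->
  g i n = k -> v%:R `^ (m%:R * t i) <= phi n)
  f_iIFS xi_gt0 f_regular dig_digits D_pos Dd0) => //.
(* The second entry of [threshold] is there for this: [min D] is at least 1, so its power grows with
   the exponent [m * t i]. *)
- move=> k _ n i n0 _; apply: le_trans (phi_ge n n0).
  rewrite le_max; apply/orP; right; apply: ler_powR => //.
  by rewrite ler_wpM2l//; exact: le_bigmax.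
- move=> v _.
  have [N0 _ HN0] : \forall n \near \oo, forall i : 'I_m,
      v%:R `^ (m%:R * t i) <= phi n.
    by apply: filter_forall => i; move/cvgryPge: phi_infty; exact.
  (* A position [k] may equal [g i n] for infinitely many [n], but only the [n] below [N0] can
     violate the bound, and [k] exceeds all their [g i n]. *)
  exists (\max_(n < N0) \max_(i < m) g i n).+1 => k Nk n i n0 gk.
  have [nN0|] := ltnP n N0; last by move=> /HN0.
  move: Nk; rewrite -gk ltnNge.
  rewrite (leq_trans (leq_bigmax i) (leq_bigmax (Ordinal nN0)))//.
- by move=> x [].
move=> x [Ex Gx]; split => // n n0.
have root i : (dig x (g i n))%:R `^ t i <= phi n `^ (m%:R^-1).
  rewrite -[t i](mulKf mR0) mulrC powRrM ge0_ler_powR ?invr_ge0 ?nnegrE ?powR_ge0 ?phi_ge0//.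
  exact: (Gx _ (g_pos i n n0) n i n0 erefl).
apply: (@le_trans _ _ (\prod_(i < m) phi n `^ (m%:R^-1))).
  by apply: ler_prod => i _; rewrite powR_ge0 root.
rewrite prodr_const card_ord -powR_mulrn ?powR_ge0// -powRrM mulVf//.
by rewrite powRr1// phi_ge0.
Qed.
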